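(* Let $A=U\ltimes H\rtimes G$ with $U=u_q\mathfrak{sl}_2$, $H=\mathrm{SF}_{2p}$, $G=\mathbb K[S_p]$, with the quasitriangular structure $R=R_{\mathsf z}D\Theta\bar R_{\boldsymbol\alpha}$ and left integral $\lambda$ described in the context, and let $M=R_{21}R=M'\otimes M''$ be its monodromy matrix. Then $\lambda(S(M'))\lambda(M'')\neq0$. Thus, the resulting invariant of 4-manifolds is susceptible to ($S^2\times S^2$-)stabilisation.
   Context: $p>2$ is a prime, $\mathbb K$ an algebraically closed field of characteristic $p$, $q\in\mathbb K$ a primitive $r$-th root of unity with $r$ divisible by $8$ and coprime to $p$; $r'=r/2$, $r''=r/4$, $\{k\}=q^k-q^{-k}$, $[k]=\{k\}/\{1\}$, $[k]!=[k]\cdots[1]$. ''Susceptible to stabilisation'' refers to the scalar $\lambda(S(M'))\lambda(M'')$, the invariant of $S^2\times S^2$, being invertible in $\mathbb K$. The algebra $A$: generated over $\mathbb K$ by $K,E,F$, $L$, $Z_l^{\pm}$ ($1\le l\le p$) and the elements $\sigma\in S_p$, with relations: $K^{r'}=1$, $E^{r'}=F^{r'}=0$, $KEK^{-1}=q^2E$, $KFK^{-1}=q^{-2}F$, $[E,F]=\frac{K-K^{-1}}{q-q^{-1}}$; $L^2=1$, $LZ_l^\pm=-Z_l^\pm L$, all $Z_l^{\pm}$ square to zero and pairwise anticommute; $L$ commutes with $K,E,F$; $KZ_l^\pm=-Z_l^\pm K$, $EZ_l^\pm=-Z_l^\pm E$, $FZ_l^\pm=Z_l^\pm F$; elements of $S_p$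 multiply as in $S_p$, commute with $E,F,K,L$, and $\sigma Z_l^\pm=Z^\pm_{\sigma(l)}\sigma$. Put $\bar L=K^{r''}L$. Hopf structure: $K,L,\sigma$ grouplike; $\Delta(E)=1\otimes E+E\otimes K$, $\Delta(F)=F\otimes1+K^{-1}\otimes F$, $\Delta(Z_l^\pm)=1\otimes Z_l^\pm+Z_l^\pm\otimes\bar L$; $\epsilon(E)=\epsilon(F)=\epsilon(Z_l^\pm)=0$; $S(E)=-EK^{-1}$, $S(F)=-KF$, $S(Z_l^\pm)=-Z_l^\pm\bar L$. R-matrix: $R=R_{\mathsf z}D\Theta\bar R_{\boldsymbol\alpha}$, $R_{\mathsf z}=\frac12\sum_{v,w\in\{0,1\}}(-1)^{vw}L^w\otimes L^v$, $D=\frac1{r'}\sum_{b,c=0}^{r'-1}q^{-2bc}K^b\otimes K^c$, $\Theta=\sum_{a=0}^{r'-1}\frac{\{1\}^a}{[a]!}q^{a(a-1)/2}E^a\otimes F^a$, $\bar R_{\boldsymbol\alpha}=\exp\big(\sum_{l=1}^p\alpha_l(Z_l^+\otimes\bar LZ_l^--Z_l^-\otimes\bar LZ_l^+)\big)$ (the exponential is formal, enumerating all products of the commuting square-zero summands), where the tuple $\boldsymbol\alpha=(\alpha_1,\dots,\alpha_p)$ has only non-zero entries in $\mathbb K$. Left integral: $\lambda\in A^*$ with $\lambda(h_{(2)})h_{(1)}=\lambda(h)1$ for all $h\in A$, given in the basis $E^eF^fK^aL^b\prod_l(Z_l^+)^{g_l}(Z_l^-)^{h_l}\,\sigma$ by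 the value $\frac{\sqrt{r''}[r'-1]!}{\{1\}^{r'-1}}$ at $e=f=a=r'-1$, $b=0$, all $g_l=h_l=1$, $\sigma=1$, and zero on all other basis elements. *)

(* Defs.v *)
From HB Require Import structures.
From mathcomp Require Import all_boot all_order all_algebra all_fingroup.
From mathcomp Require Import boolp finmap.
From mathcomp.multinomials Require Import monalg.

Set Implicit Arguments.
Unset Strict Implicit.
Unset Printing Implicit Defensive.

Import GRing.Theory.
Local Open Scope ring_scope.
Local Open Scope quotient_scope.

Fact malg_scalerAr (K : comNzRingType) (M : monomType) (c : K)
  (x y : {malg K[M]}) : c *: (x * y) = x * (c *: y).
Proof.
apply/malgP => k; rewrite mcoeffZ.
rewrite (mcoeffMlw k (fsubset_refl _) (msuppZ_le c y)) mcoeffMl mulr_sumr.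
apply: eq_bigr => k1 _; rewrite mulr_sumr; apply: eq_bigr => k2 _.
by rewrite mcoeffZ mulrnAr mulrCA.
Qed.

Definition free_alg (K : comNzRingType) (I : choiceType) :=
  {malg K[{fmonom I}]}.

Section FreeAlg.
Variables (K : comNzRingType) (I : choiceType).
Local Notation F := (free_alg K I).

HB.instance Definition _ := GRing.Lalgebra.on F.
HB.instance Definition _ :=
  GRing.Lalgebra_isAlgebra.Build K F (@malg_scalerAr K {fmonom I}).

Definition free_gen (i : I) : F := << fmu i >>%R.

Section FreeChar.
Variable v : I -> K.

Definition word_eval (m : {fmonom I}) : K := \prod_(i <- m) v i.

Fact word_eval_mmorphism : mmorphism word_eval.
Proof.
rewrite /word_eval; split=> [m1 m2|]; last by rewrite fm1 big_nil.
by rewrite fmM big_cat.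
Qed.

HB.instance Definition _ :=
  isMultiplicative.Build _ _ word_eval word_eval_mmorphism.

Definition free_char : F -> K := mmap idfun word_eval.

HB.instance Definition _ := GRing.RMorphism.copy free_char (mmap idfun word_eval).
HB.instance Definition _ := GRing.Linear.copy free_char (mmap idfun word_eval).

Lemma free_charE i : free_char (free_gen i) = v i.
Proof.
by rewrite /free_char /free_gen mmapU mul1r /word_eval fmU big_cons big_nil mulr1.
Qed.
End FreeChar.
End FreeAlg.

Section QuotientAlgebra.
Variables (K : comNzRingType) (F : algType K) (rel : F -> F -> Prop).

Definition two_sided_ideal (J : F -> Prop) : Prop :=
  [/\ J 0, forall x y, J x -> J y -> J (x - y),
      forall a x, J x -> J (a * x) & forall a x, J x -> J (x * a)].

Definition gen_ideal (x : F) : Prop :=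
  forall J, two_sided_ideal J -> (forall a b, rel a b -> J (a - b)) -> J x.

Fact gen_idealP : two_sided_ideal gen_ideal.
Proof.
split=> [J [J0 _ _ _] _|x y Jx Jy J HJ Hr|a x Jx J HJ Hr|a x Jx J HJ Hr].
- exact: J0.
- by case: (HJ) => _ JB _ _; apply: JB; [apply: Jx | apply: Jy].
- by case: (HJ) => _ _ Jl _; apply: Jl; apply: Jx.
- by case: (HJ) => _ _ _ Jr; apply: Jr; apply: Jx.
Qed.

Definition gen_ideal_pred : {pred F} := fun x => `[< gen_ideal x >].

Fact gen_ideal_zmod_closed : zmod_closed gen_ideal_pred.
Proof.
have [I0 IB _ _] := gen_idealP.
split=> [|x y /asboolP Ix /asboolP Iy]; apply/asboolP => //.
exact: IB.
Qed.

HB.instance Definition _ :=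
  GRing.isZmodClosed.Build F gen_ideal_pred gen_ideal_zmod_closed.

(* Properness is only needed because algType excludes the zero ring. *)
Definition quot_alg of ~ gen_ideal 1 := Quotient.quot gen_ideal_pred.

Hypothesis proper : ~ gen_ideal 1.
Local Notation Q := (quot_alg proper).

HB.instance Definition _ := GRing.Zmodule.on Q.

Definition qproj (x : F) : Q := \pi_(Quotient.quot gen_ideal_pred) x.
Definition qrepr (u : Q) : F := generic_quotient.repr (u : Quotient.quot gen_ideal_pred).

Lemma qreprK : cancel qrepr qproj. Proof. exact: reprK. Qed.

Lemma qprojP (x y : F) : qproj x = qproj y <-> gen_ideal (x - y).
Proof.
split=> [/eqmodP|H]; first by move/asboolP.
by apply/eqmodP/asboolP.
Qed.

Fact qprojB : {morph qproj : x y / x - y}.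
Proof. by move=> x y; rewrite /qproj !piE. Qed.
HB.instance Definition _ := GRing.isZmodMorphism.Build F Q qproj qprojB.

Definition qmul (u v : Q) : Q := qproj (qrepr u * qrepr v).
Definition qscale (c : K) (u : Q) : Q := qproj (c *: qrepr u).

Fact qprojM_subproof x y : qmul (qproj x) (qproj y) = qproj (x * y).
Proof.
have [I0 IB Il Ir] := gen_idealP.
have ID a b : gen_ideal a -> gen_ideal b -> gen_ideal (a + b).
  by move=> Ia Ib; rewrite -[b]opprK -[- b]sub0r; apply: (IB) => //; apply: (IB).
apply/qprojP.
rewrite -[_ * _](subrK (qrepr (qproj x) * y)) -mulrBr -addrA -mulrBl.
by apply: ID; [apply: Il | apply: Ir]; apply/qprojP; rewrite qreprK.
Qed.

Fact qprojZ_subproof c x : qscale c (qproj x) = qproj (c *: x).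
Proof.
have [_ _ Il _] := gen_idealP.
apply/qprojP; rewrite -scalerBr -mulr_algl; apply: Il.
by apply/qprojP; rewrite qreprK.
Qed.

Fact qmulA : associative qmul.
Proof.
move=> u v w; rewrite -[u]qreprK -[v]qreprK -[w]qreprK.
by rewrite !qprojM_subproof mulrA.
Qed.

Fact qmul1r : left_id (qproj 1) qmul.
Proof. by move=> u; rewrite -[u]qreprK qprojM_subproof mul1r. Qed.

Fact qmulr1 : right_id (qproj 1) qmul.
Proof. by move=> u; rewrite -[u]qreprK qprojM_subproof mulr1. Qed.

Fact qmulDl : left_distributive qmul +%R.
Proof.
move=> u v w; rewrite -[u]qreprK -[v]qreprK -[w]qreprK.
by rewrite -raddfD !qprojM_subproof -raddfD mulrDl.
Qed.

Fact qmulDr : right_distributive qmul +%R.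
Proof.
move=> u v w; rewrite -[u]qreprK -[v]qreprK -[w]qreprK.
by rewrite -raddfD !qprojM_subproof -raddfD mulrDr.
Qed.

Fact qone_neq0 : qproj 1 != 0.
Proof. by apply/eqP => H; apply: proper; rewrite -[1]subr0; apply/qprojP; rewrite H raddf0. Qed.

HB.instance Definition _ := GRing.Zmodule_isNzRing.Build Q
  qmulA qmul1r qmulr1 qmulDl qmulDr qone_neq0.

Fact qscalerA c d u : qscale c (qscale d u) = qscale (c * d) u.
Proof. by rewrite -[u]qreprK !qprojZ_subproof scalerA. Qed.

Fact qscale1r : left_id 1 qscale.
Proof. by move=> u; rewrite -[u]qreprK qprojZ_subproof scale1r. Qed.

Fact qscalerDr : right_distributive qscale +%R.
Proof.
move=> c u v; rewrite -[u]qreprK -[v]qreprK.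
by rewrite -raddfD !qprojZ_subproof -raddfD scalerDr.
Qed.

Fact qscalerDl u : {morph qscale^~ u : c d / c + d}.
Proof.
by move=> c d; rewrite -[u]qreprK /= !qprojZ_subproof -raddfD scalerDl.
Qed.

HB.instance Definition _ := GRing.Zmodule_isLmodule.Build K Q
  qscalerA qscale1r qscalerDr qscalerDl.

Fact qscalerAl c (u v : Q) : c *: (u * v) = (c *: u) * v.
Proof.
rewrite -[u]qreprK -[v]qreprK; rewrite /GRing.scale /GRing.mul /=.
by rewrite !(qprojM_subproof, qprojZ_subproof) scalerAl.
Qed.

HB.instance Definition _ := GRing.Lmodule_isLalgebra.Build K Q qscalerAl.

Fact qscalerAr c (u v : Q) : c *: (u * v) = u * (c *: v).
Proof.
rewrite -[u]qreprK -[v]qreprK; rewrite /GRing.scale /GRing.mul /=.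
by rewrite !(qprojM_subproof, qprojZ_subproof) scalerAr.
Qed.

HB.instance Definition _ := GRing.Lalgebra_isAlgebra.Build K Q qscalerAr.

Fact qproj_monoid_morphism : monoid_morphism qproj.
Proof. by split=> // x y; rewrite -qprojM_subproof. Qed.

HB.instance Definition _ :=
  GRing.isMonoidMorphism.Build F Q qproj qproj_monoid_morphism.

Fact qproj_scalable : scalable qproj.
Proof. by move=> c x; rewrite -qprojZ_subproof. Qed.

HB.instance Definition _ :=
  GRing.isScalable.Build K F Q *:%R qproj qproj_scalable.

Lemma qproj_rel a b : rel a b -> qproj a = qproj b.
Proof. by move=> Hab; apply/qprojP => J _; apply. Qed.

End QuotientAlgebra.


Section Tensor.
Variables (K : comNzRingType) (A B : algType K).

Definition formal_eval (V : lmodType K) (f : A -> B -> V) (s : seq (A * B)) : V :=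
  \sum_(x <- s) f x.1 x.2.

(* Formal sums of pairs, identified when every bilinear map into a K-module
   takes the same value on them. *)
Definition tensor_eq : rel (seq (A * B)) := fun s t =>
  `[< forall (V : lmodType K) (f : A -> B -> V),
        bilinear_for *:%R *:%R f -> formal_eval f s = formal_eval f t >].

Fact tensor_eq_equiv : equiv_class_of tensor_eq.
Proof.
split=> [s|s t|t s u]; first exact/asboolP.
  by apply/asboolP/asboolP => H V f Hf; rewrite H.
by move=> /asboolP H1 /asboolP H2; apply/asboolP => V f Hf; rewrite H1 ?H2.
Qed.

Canonical tensor_eq_equivRel := EquivRelPack tensor_eq_equiv.
Canonical tensor_eq_encModRel := defaultEncModRel tensor_eq.

Definition tensor := {eq_quot tensor_eq}.
HB.instance Definition _ := Choice.on tensor.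

Definition tproj (s : seq (A * B)) : tensor := \pi_tensor s.

Definition tens (a : A) (b : B) : tensor := tproj [:: (a, b)].

(* The linear map induced by f; meaningful for bilinear f only. *)
Definition tlift (V : lmodType K) (f : A -> B -> V) (t : tensor) : V :=
  formal_eval f (generic_quotient.repr t).

Lemma tlift_proj (V : lmodType K) (f : A -> B -> V) s :
  bilinear_for *:%R *:%R f -> tlift f (tproj s) = formal_eval f s.
Proof.
move=> Hf; rewrite /tlift /tproj; have /eqmodP/asboolP-> // := reprK (tproj s).
Qed.

Lemma tensorP (t u : tensor) :
  (forall (V : lmodType K) (f : A -> B -> V),
     bilinear_for *:%R *:%R f -> tlift f t = tlift f u) -> t = u.
Proof.
move=> H; rewrite -[t]reprK -[u]reprK; apply/eqmodP/asboolP => V f Hf.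
exact: H.
Qed.

Lemma tlift_tens (V : lmodType K) (f : A -> B -> V) a b :
  bilinear_for *:%R *:%R f -> tlift f (tens a b) = f a b.
Proof. by move=> Hf; rewrite tlift_proj // /formal_eval big_seq1. Qed.

Definition tzero : tensor := tproj [::].
Definition tadd (t u : tensor) : tensor :=
  tproj (generic_quotient.repr t ++ generic_quotient.repr u).
Definition tscale (c : K) (t : tensor) : tensor :=
  tproj [seq (c *: x.1, x.2) | x <- generic_quotient.repr t].
Definition tone : tensor := tens 1 1.
Definition tmul (t u : tensor) : tensor :=
  tproj [seq (x.1 * y.1, x.2 * y.2) | x <- generic_quotient.repr t,
                                      y <- generic_quotient.repr u].

Section TensorLemmas.
Variables (V : lmodType K) (f : A -> B -> V).
Hypothesis Hf : bilinear_for *:%R *:%R f.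

Fact tlift0 : tlift f tzero = 0.
Proof. by rewrite tlift_proj // /formal_eval big_nil. Qed.

Fact tliftD t u : tlift f (tadd t u) = tlift f t + tlift f u.
Proof. by rewrite tlift_proj // /formal_eval big_cat. Qed.

Fact tliftZ c t : tlift f (tscale c t) = c *: tlift f t.
Proof.
rewrite tlift_proj // /tlift /formal_eval big_map scaler_sumr.
apply: eq_bigr => x _ /=.
by have := Hf.1 x.2 c x.1 0; rewrite !addr0 /= => ->;
  rewrite -[X in _ + X]add0r; have := Hf.1 x.2 (-1) 0 0;
  rewrite scaler0 addr0 /= scaleN1r addNr => ->; rewrite !addr0.
Qed.

Lemma bilinear_mull a b : bilinear_for *:%R *:%R (fun x y => f (a * x) (b * y)).
Proof.
split=> [y c x x'|x c y y'] /=.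
  by rewrite mulrDr -scalerAr (Hf.1 _ c).
by rewrite mulrDr -scalerAr (Hf.2 _ c).
Qed.

Lemma bilinear_mulr a b : bilinear_for *:%R *:%R (fun x y => f (x * a) (y * b)).
Proof.
split=> [y c x x'|x c y y'] /=.
  by rewrite mulrDl -scalerAl (Hf.1 _ c).
by rewrite mulrDl -scalerAl (Hf.2 _ c).
Qed.

Fact tliftMl t u :
  tlift f (tmul t u) =
  tlift (fun a b => tlift (fun a' b' => f (a * a') (b * b')) u) t.
Proof.
by rewrite tlift_proj // /tlift /formal_eval big_allpairs_dep.
Qed.

Fact tliftMr t u :
  tlift f (tmul t u) =
  tlift (fun a' b' => tlift (fun a b => f (a * a') (b * b')) t) u.
Proof.
by rewrite tliftMl /tlift /formal_eval exchange_big.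
Qed.

End TensorLemmas.

Fact taddA : associative tadd.
Proof. by move=> t u v; apply: tensorP => V f Hf; rewrite !tliftD // addrA. Qed.

Fact taddC : commutative tadd.
Proof. by move=> t u; apply: tensorP => V f Hf; rewrite !tliftD // addrC. Qed.

Fact tadd0 : left_id tzero tadd.
Proof. by move=> t; apply: tensorP => V f Hf; rewrite tliftD // tlift0 // add0r. Qed.

Fact taddN : left_inverse tzero (tscale (-1)) tadd.
Proof.
move=> t; apply: tensorP => V f Hf.
by rewrite tliftD // tliftZ // tlift0 // scaleN1r addNr.
Qed.

HB.instance Definition _ := GRing.isZmodule.Build tensor taddA taddC tadd0 taddN.

Fact tscaleA c d t : tscale c (tscale d t) = tscale (c * d) t.
Proof. by apply: tensorP => V f Hf; rewrite !tliftZ // scalerA. Qed.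

Fact tscale1 : left_id 1 tscale.
Proof. by move=> t; apply: tensorP => V f Hf; rewrite tliftZ // scale1r. Qed.

Fact tscaleDr : right_distributive tscale +%R.
Proof.
move=> c t u; apply: tensorP => V f Hf.
by rewrite [_ + _]/(tadd _ _) [_ + _ in RHS]/(tadd _ _) !(tliftZ, tliftD) // scalerDr.
Qed.

Fact tscaleDl t : {morph tscale^~ t : c d / c + d}.
Proof.
move=> c d; apply: tensorP => V f Hf.
by rewrite [_ + _ in RHS]/(tadd _ _) !(tliftZ, tliftD) // scalerDl.
Qed.

HB.instance Definition _ := GRing.Zmodule_isLmodule.Build K tensor
  tscaleA tscale1 tscaleDr tscaleDl.

Fact tmulA : associative tmul.
Proof.
move=> t u v; apply: tensorP => V f Hf.
rewrite tliftMl // [RHS]tliftMr // /tlift.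
transitivity (formal_eval (fun a b => tlift (fun a' b' =>
    tlift (fun a'' b'' => f (a * a' * a'') (b * b' * b'')) v) u)
  (generic_quotient.repr t)).
  apply: eq_bigr => x _; rewrite -[LHS]/(tlift _ (tmul u v)).
  rewrite tliftMl; last exact: bilinear_mull.
  by apply: eq_bigr => y _; apply: eq_bigr => z _; rewrite !mulrA.
rewrite /formal_eval /tlift /formal_eval /=.
transitivity (\sum_(x <- generic_quotient.repr t)
  \sum_(z <- generic_quotient.repr v) \sum_(y <- generic_quotient.repr u)
    f (x.1 * y.1 * z.1) (x.2 * y.2 * z.2)).
  by apply: eq_bigr => x _; rewrite exchange_big.
rewrite [LHS]exchange_big; apply: eq_bigr => z _.
rewrite -[RHS]/(tlift (fun a b => f (a * z.1) (b * z.2)) (tmul t u)) tliftMl //.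
exact: bilinear_mulr.
Qed.

Fact tmul1 : left_id tone tmul.
Proof.
move=> t; apply: tensorP => V f Hf; rewrite tliftMr // /tlift.
apply: eq_bigr => x _; rewrite -[LHS]/(tlift _ _) tlift_tens ?mul1r //.
exact: bilinear_mulr.
Qed.

Fact tmulr1 : right_id tone tmul.
Proof.
move=> t; apply: tensorP => V f Hf; rewrite tliftMl // /tlift.
apply: eq_bigr => x _; rewrite -[LHS]/(tlift _ _) tlift_tens ?mulr1 //.
exact: bilinear_mull.
Qed.

Fact tmulDl : left_distributive tmul +%R.
Proof.
move=> t u v; apply: tensorP => V f Hf.
rewrite [_ + _ in RHS]/(tadd _ _) tliftD // !tliftMr // /tlift -big_split.
apply: eq_bigr => x _; rewrite -[LHS]/(tlift _ (tadd _ _)) tliftD //.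
exact: bilinear_mulr.
Qed.

Fact tmulDr : right_distributive tmul +%R.
Proof.
move=> t u v; apply: tensorP => V f Hf.
rewrite [_ + _ in RHS]/(tadd _ _) tliftD // !tliftMl // /tlift -big_split.
apply: eq_bigr => x _; rewrite -[LHS]/(tlift _ (tadd _ _)) tliftD //.
exact: bilinear_mull.
Qed.

HB.instance Definition _ := GRing.Zmodule_isPzRing.Build tensor
  tmulA tmul1 tmulr1 tmulDl tmulDr.

Lemma tlift_linear (V : lmodType K) (f : A -> B -> V) :
  bilinear_for *:%R *:%R f -> linear (tlift f).
Proof.
by move=> Hf c t u; rewrite -[_ + u]/(tadd (tscale c t) u) tliftD // tliftZ.
Qed.

Lemma tens_bilinear : bilinear_for *:%R *:%R tens.
Proof.
split=> [b c a a'|a c b b'] /=; apply: tensorP => V f Hf;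
  by rewrite [RHS](tlift_linear Hf) !tlift_tens // (Hf.1, Hf.2) /= ?(Hf.1 _ c) ?(Hf.2 _ c).
Qed.

Lemma tensM a b a' b' : tens a b * tens a' b' = tens (a * a') (b * b').
Proof.
apply: tensorP => V f Hf; rewrite tliftMl // !tlift_tens //.
  exact: bilinear_mull.
split=> [y c x x'|x c y y'] /=; rewrite !tlift_tens; do ?exact: bilinear_mull.
  by rewrite (bilinear_mulr Hf _ _).1.
by rewrite (bilinear_mulr Hf _ _).2.
Qed.

End Tensor.

Definition tswap (K : comNzRingType) (A B : algType K) : tensor A B -> tensor B A :=
  tlift (fun a b => tens b a).

Section FormalExp.
Variables (T : pzRingType) (I : finType) (x : I -> T).

(* exp (\sum_i x i) for commuting square-zero x i: in the k-th power of the
   sum each k-element set of indices contributes its product k`! times, which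
   cancels the denominator k`!; so no factorial has to be invertible. *)
Definition formal_exp : T := \sum_(J : {set I}) \prod_(i in J) x i.
End FormalExp.

Section QuantumNumbers.
Variables (K : fieldType) (q : K).

Definition qbrace (k : nat) : K := q ^+ k - q ^- k.
Definition qnum (k : nat) : K := qbrace k / qbrace 1.
Definition qfact (k : nat) : K := \prod_(1 <= i < k.+1) qnum i.
End QuantumNumbers.

(* GenZ true l is Z_l^+ and GenZ false l is Z_l^-. *)
Inductive gen (p : nat) : Type :=
  GenK | GenE | GenF | GenL | GenZ of bool & 'I_p | GenS of 'S_p.
Arguments GenK {p}.
Arguments GenE {p}.
Arguments GenF {p}.
Arguments GenL {p}.
Arguments GenZ {p}.
Arguments GenS {p}.

Section GenChoice.
Variable p : nat.

Definition gen_code (g : gen p) : 'I_4 + bool * 'I_p + 'S_p :=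
  match g with
  | GenK => inl (inl (inord 0))
  | GenE => inl (inl (inord 1))
  | GenF => inl (inl (inord 2))
  | GenL => inl (inl (inord 3))
  | GenZ s l => inl (inr (s, l))
  | GenS w => inr w
  end.

Definition gen_decode (c : 'I_4 + bool * 'I_p + 'S_p) : gen p :=
  match c with
  | inl (inl i) => nth GenK [:: GenK; GenE; GenF; GenL] i
  | inl (inr (s, l)) => GenZ s l
  | inr w => GenS w
  end.

Fact gen_codeK : cancel gen_code gen_decode.
Proof. by case=> //=; rewrite inordK. Qed.

HB.instance Definition _ := Choice.copy (gen p) (can_type gen_codeK).
End GenChoice.

Section Relations.
Variables (K : fieldType) (p r : nat) (q : K) (F : algType K) (x : gen p -> F).

Local Notation k := (x GenK).
Local Notation kV := (x GenK ^+ (r./2).-1).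
Local Notation e := (x GenE).
Local Notation f := (x GenF).
Local Notation L := (x GenL).
Local Notation Z s l := (x (GenZ s l)).
Local Notation W w := (x (GenS w)).

(* K^-1 is K^(r' - 1).  The product of S_p is composition of maps,
   (w w')(l) = w (w' l), as forced by w Z_l = Z_(w l) w; in the group law of
   'S_p this is (w' * w)%g. *)
Inductive uhg_rel : F -> F -> Prop :=
| rel_KX : uhg_rel (k ^+ r./2) 1
| rel_EX : uhg_rel (e ^+ r./2) 0
| rel_FX : uhg_rel (f ^+ r./2) 0
| rel_KE : uhg_rel (k * e * kV) (q ^+ 2 *: e)
| rel_KF : uhg_rel (k * f * kV) (q ^- 2 *: f)
| rel_EF : uhg_rel (e * f - f * e) ((q - q^-1)^-1 *: (k - kV))
| rel_LX : uhg_rel (L ^+ 2) 1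
| rel_LZ s l : uhg_rel (L * Z s l) (- (Z s l * L))
| rel_ZX s l : uhg_rel (Z s l ^+ 2) 0
| rel_ZZ s l t m : uhg_rel (Z s l * Z t m) (- (Z t m * Z s l))
| rel_LK : uhg_rel (L * k) (k * L)
| rel_LE : uhg_rel (L * e) (e * L)
| rel_LF : uhg_rel (L * f) (f * L)
| rel_KZ s l : uhg_rel (k * Z s l) (- (Z s l * k))
| rel_EZ s l : uhg_rel (e * Z s l) (- (Z s l * e))
| rel_FZ s l : uhg_rel (f * Z s l) (Z s l * f)
| rel_S1 : uhg_rel (W 1%g) 1
| rel_SS w w' : uhg_rel (W w * W w') (W (w' * w)%g)
| rel_SE w : uhg_rel (W w * e) (e * W w)
| rel_SF w : uhg_rel (W w * f) (f * W w)
| rel_SK w : uhg_rel (W w * k) (k * W w)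
| rel_SL w : uhg_rel (W w * L) (L * W w)
| rel_SZ w s l : uhg_rel (W w * Z s l) (Z s (w l) * W w).

End Relations.

Section Presentation.
Variables (K : fieldType) (p r : nat) (q : K).

Definition gen_counit (g : gen p) : K :=
  match g with
  | GenK | GenL | GenS _ => 1
  | GenE | GenF | GenZ _ _ => 0
  end.

Fact gen_counit_rel (F : algType K) (x : gen p -> F)
    (phi : {rmorphism F -> K}) (a b : F) :
  scalar phi -> (forall g, phi (x g) = gen_counit g) -> (0 < r./2)%N ->
  uhg_rel r q x a b -> phi a = phi b.
Proof.
move=> philin phig r_gt0.
have phiZ c y : phi (c *: y) = c * phi y.
  by have := philin c y 0; rewrite !addr0 rmorph0 addr0.
have r0 : (r./2 == 0)%N = false by rewrite gtn_eqF.
by case=> *; rewrite ?phiZ ?(rmorphM, rmorphN, rmorphXn, rmorphB, rmorph1, rmorph0) /=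
    ?phig /= ?expr1n ?expr0n ?r0 ?(mulr0, mul0r, mulr1, mul1r) ?subrr ?oppr0 ?mulr0.
Qed.

Hypotheses (r_dvd8 : (8 %| r)%N) (q_prim : r.-primitive_root q).

Local Notation rel := (uhg_rel r q (@free_gen K (gen p))).

Fact half_gt0 : (0 < r./2)%N.
Proof.
have := prim_order_gt0 q_prim.
by case/dvdnP: r_dvd8 => [[|m]] ->; rewrite // mulSn.
Qed.

Fact uhg_rel_proper : ~ gen_ideal rel 1.
Proof.
pose phi : {rmorphism free_alg K (gen p) -> K} := free_char gen_counit.
move=> /(_ (fun x => phi x = 0)) H; have /eqP : phi 1 = 0.
  apply: H => [|a b ab].
    split=> [|x y Hx Hy|a x Hx|a x Hx]; first exact: raddf0.
    - by rewrite raddfB /= Hx Hy subrr.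
    - by rewrite rmorphM /= Hx mulr0.
    - by rewrite rmorphM /= Hx mul0r.
  rewrite raddfB /= (gen_counit_rel _ _ half_gt0 ab) ?subrr //.
    exact: linearP.
  exact: free_charE.
by rewrite rmorph1 oner_eq0.
Qed.

(* The algebra A = U ⋉ H ⋊ G. *)
Definition uhg : algType K := quot_alg uhg_rel_proper.

Definition uhg_gen (g : gen p) : uhg := qproj uhg_rel_proper (free_gen K g).

Lemma uhg_genP (a b : free_alg K (gen p)) :
  rel a b -> qproj uhg_rel_proper a = qproj uhg_rel_proper b.
Proof. exact: qproj_rel. Qed.

End Presentation.

Notation "x ⊗ y" := (tens x y) (at level 40, left associativity).

Section Structure.
Variables (K : fieldType) (p r : nat) (q : K).
Hypotheses (r_dvd8 : (8 %| r)%N) (q_prim : r.-primitive_root q).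

Local Notation A := (uhg p r_dvd8 q_prim).

Definition aK : A := uhg_gen r_dvd8 q_prim GenK.
Definition aKV : A := aK ^+ (r./2).-1.
Definition aE : A := uhg_gen r_dvd8 q_prim GenE.
Definition aF : A := uhg_gen r_dvd8 q_prim GenF.
Definition aL : A := uhg_gen r_dvd8 q_prim GenL.
Definition aZ (s : bool) (l : 'I_p) : A := uhg_gen r_dvd8 q_prim (GenZ s l).
Definition aS (w : 'S_p) : A := uhg_gen r_dvd8 q_prim (GenS w).
Definition aLbar : A := aK ^+ (r %/ 4)%N * aL.

(* The coproduct and the counit are algebra maps and the antipode is an
   algebra anti-map, so all three are determined by the values on generators. *)
Record hopf_structure : Type := HopfStructure {
  coprod : {linear A -> tensor A A};
  coprod_monoid_morphism : monoid_morphism coprod;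
  coprodK : coprod aK = aK ⊗ aK;
  coprodL : coprod aL = aL ⊗ aL;
  coprodS : forall w, coprod (aS w) = aS w ⊗ aS w;
  coprodE : coprod aE = 1 ⊗ aE + aE ⊗ aK;
  coprodF : coprod aF = aF ⊗ 1 + aKV ⊗ aF;
  coprodZ : forall s l, coprod (aZ s l) = 1 ⊗ aZ s l + aZ s l ⊗ aLbar;
  counit : {lrmorphism A -> K^o};
  counitK : counit aK = 1;
  counitL : counit aL = 1;
  counitS : forall w, counit (aS w) = 1;
  counitE : counit aE = 0;
  counitF : counit aF = 0;
  counitZ : forall s l, counit (aZ s l) = 0;
  antipode : {linear A -> A};
  antipode1 : antipode 1 = 1;
  antipodeM : forall x y, antipode (x * y) = antipode y * antipode x;
  antipodeK : antipode aK = aKV;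
  antipodeL : antipode aL = aL;
  antipodeS : forall w, antipode (aS w) = aS (w^-1)%g;
  antipodeE : antipode aE = - (aE * aKV);
  antipodeF : antipode aF = - (aK * aF);
  antipodeZ : forall s l, antipode (aZ s l) = - (aZ s l * aLbar)
}.

Definition Rz : tensor A A :=
  2%:R^-1 *: \sum_(v < 2) \sum_(w < 2)
    (-1) ^+ (v * w) *: (aL ^+ w ⊗ aL ^+ v).

Definition Dmx : tensor A A :=
  (r./2)%:R^-1 *: \sum_(b < r./2) \sum_(c < r./2)
    q ^- (2 * b * c) *: (aK ^+ b ⊗ aK ^+ c).

Definition Theta : tensor A A :=
  \sum_(a < r./2) (qbrace q 1 ^+ a / qfact q a * q ^+ (a * a.-1)./2) *:
    (aE ^+ a ⊗ aF ^+ a).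

Definition Ralpha (alpha : 'I_p -> K) : tensor A A :=
  formal_exp (fun i : 'I_p * bool =>
    let: (l, s) := i in
    (if s then alpha l else - alpha l) *: (aZ s l ⊗ (aLbar * aZ (~~ s) l))).

Definition Rmatrix (alpha : 'I_p -> K) : tensor A A :=
  Rz * Dmx * Theta * Ralpha alpha.

Definition monodromy (R : tensor A A) : tensor A A := tswap R * R.

(* lambda(h_(2)) h_(1) = lambda(h) 1. *)
Definition left_integral (H : hopf_structure) (lambda : {scalar A}) : Prop :=
  forall h : A, tlift (fun h1 h2 => lambda h2 *: h1) (coprod H h) = lambda h *: 1.

Definition basis_elt (e f a b : nat) (g h : 'I_p -> bool) (w : 'S_p) : A :=
  aE ^+ e * aF ^+ f * aK ^+ a * aL ^+ b *
  (\prod_(l < p) (aZ true l ^+ g l * aZ false l ^+ h l)) * aS w.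

(* rt stands for a chosen square root of r''. *)
Definition integral_values (rt : K) (lambda : {scalar A}) : Prop :=
  forall e f a b : nat, (e < r./2)%N -> (f < r./2)%N -> (a < r./2)%N -> (b < 2)%N ->
  forall (g h : 'I_p -> bool) (w : 'S_p),
  lambda (basis_elt e f a b g h w) =
    if [&& e == (r./2).-1, f == (r./2).-1, a == (r./2).-1, b == 0%N,
           [forall l, g l && h l] & w == 1%g]
    then rt * qfact q (r./2).-1 / qbrace q 1 ^+ (r./2).-1 else 0.

(* The scalar lambda(S(M')) lambda(M''), the invariant of S^2 x S^2. *)
Definition S2xS2_invariant (H : hopf_structure) (lambda : {scalar A})
    (M : tensor A A) : K :=
  tlift (fun m' m'' => lambda (antipode H m') * lambda m'' : K^o) M.

Definition susceptible_to_stabilisation (H : hopf_structure)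
    (lambda : {scalar A}) (M : tensor A A) : Prop :=
  S2xS2_invariant H lambda M \is a GRing.unit.

End Structure.

(* Main.v *)
(* R_z D intertwines the flipped exponential of R_21 with the exponential of R
   (their factors are exchanged in pairs), the exponential commutes with Theta,
   R_z commutes with D and Theta_21, and R_z^2 = 1; hence
     M = R_21 R = D Theta_21 D Theta exp (2 * sum).
   The integral on the second tensor factor kills every term except those with
   E^(r'-1) F^(r'-1) and with all the Z_l^+, Z_l^-, which forces the top term of
   both copies of Theta and of the exponential; the latter contributes
   -4 alpha_l^2 for each l.  What remains is a double character sum over Z/r'
   coming from the two copies of D, where only the exponents 1 and -1 of K count;
   it is 2 r' q^-2. *)
From HB Require Import structures.
Require Import Defs.
From mathcomp Require Import all_boot all_order all_algebra all_fingroup.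
From mathcomp Require Import ring zify.

Set Implicit Arguments.
Unset Strict Implicit.
Unset Printing Implicit Defensive.

Import GRing.Theory.
Local Open Scope ring_scope.

(** * Products of commuting factors and formal exponentials *)

Section CommutingProducts.
Variable T : pzRingType.

Lemma prod_pzM (I : Type) (s : seq I) (x y : I -> T) :
  (forall i j, GRing.comm (x i) (y j)) ->
  (\prod_(i <- s) x i) * (\prod_(i <- s) y i) = \prod_(i <- s) (x i * y i).
Proof.
move=> xy; elim: s => [|i s IHs]; first by rewrite !big_nil mulr1.
rewrite !big_cons -IHs !mulrA; congr (_ * _); rewrite -!mulrA; congr (_ * _).
by apply/esym/commr_prod => j _; apply/esym/xy.
Qed.

Lemma perm_prod_comm (I : eqType) (s1 s2 : seq I) (x : I -> T) :
  (forall i j, GRing.comm (x i) (x j)) -> perm_eq s1 s2 ->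
  \prod_(i <- s1) x i = \prod_(i <- s2) x i.
Proof.
move=> xC; elim: s1 s2 => [|i s1 IHs] s2 s12.
  by move: s12; rewrite perm_sym => /perm_nilP->.
have s2i : i \in s2 by rewrite -(perm_mem s12) mem_head.
case/splitPr: s2i s12 => u v; rewrite perm_sym -cat1s perm_catCA /= perm_cons perm_sym.
move=> /IHs; rewrite big_cons big_cat /= => ->.
rewrite big_cat big_cons mulrA.
by rewrite (commr_prod u (fun j _ => xC i j)) -mulrA.
Qed.

Lemma prod_intertwine (I : Type) (s : seq I) (x y : I -> T) (w : T) :
  (forall i, x i * w = w * y i) ->
  (\prod_(i <- s) x i) * w = w * \prod_(i <- s) y i.
Proof.
move=> xy; elim: s => [|i s IHs]; first by rewrite !big_nil mulr1 mul1r.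
by rewrite !big_cons -mulrA IHs !mulrA xy.
Qed.

(** Expanding the product over subsets gives the sum. In product form an exponential can be moved
    past other elements one factor at a time. *)
Lemma formal_expE (I : finType) (x : I -> T) :
  formal_exp x = \prod_i (1 + x i).
Proof.
under [RHS]eq_bigr => i _ do rewrite addrC.
rewrite bigA_distr; apply: eq_bigr => J _.
by rewrite big_mkcond.
Qed.

(** For [x i] of square zero, [1 + x i] squares to [1 + x i *+ 2]. *)
Lemma formal_exp_sqr (I : finType) (x : I -> T) :
  (forall i j, GRing.comm (x i) (x j)) -> (forall i, x i * x i = 0) ->
  formal_exp x * formal_exp x = formal_exp (fun i => x i *+ 2).
Proof.
move=> xC x2; rewrite !formal_expE prod_pzM.
  by apply: eq_bigr => i _; rewrite mulrDl mul1r mulrDr mulr1 x2 addr0 -addrA -mulr2n.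
move=> i j; apply: commrD; first exact: commr1.
by apply/commr_sym; apply: commrD; [exact: commr1 | exact: xC].
Qed.

End CommutingProducts.

(** Serves to collapse an iterated sum whose last index has only one contributing value. *)
Lemma sum_pair_only (I J : finType) (V : nmodType) (F : I * J -> V) (j0 : J) :
  (forall i j, j != j0 -> F (i, j) = 0) -> \sum_v F v = \sum_i F (i, j0).
Proof.
move=> F0; transitivity (\sum_(v : I * J) F (v.1, v.2)).
  by apply: eq_bigr => -[].
rewrite -(pair_bigA _ (fun i j => F (i, j))) /=.
by apply: eq_bigr => i _; rewrite (bigD1 j0) //= big1 ?addr0 // => j; apply: F0.
Qed.

(** * Calculus in the tensor product algebra, and the swap of its legs *)

Section TensorAlgebra.
Variables (K : comNzRingType) (A B : algType K).
Implicit Types (t u : tensor A B).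

Lemma tensor_scalerAl (c : K) t u : c *: t * u = c *: (t * u).
Proof.
apply: tensorP => V f Hf.
rewrite -[_ * u]/(tmul (tscale c t) u) -[_ *: _]/(tscale c (tmul t u)).
rewrite tliftZ // !tliftMr // /tlift /formal_eval scaler_sumr.
by apply: eq_bigr => y _; apply/(tliftZ (bilinear_mulr Hf _ _)).
Qed.

Lemma tensor_scalerAr (c : K) t u : t * (c *: u) = c *: (t * u).
Proof.
apply: tensorP => V f Hf.
rewrite -[t * _]/(tmul t (tscale c u)) -[_ *: _]/(tscale c (tmul t u)).
rewrite tliftZ // !tliftMl // /tlift /formal_eval scaler_sumr.
by apply: eq_bigr => y _; apply/(tliftZ (bilinear_mull Hf _ _)).
Qed.

Lemma tensDl (a a' : A) (b : B) : (a + a') ⊗ b = a ⊗ b + a' ⊗ b.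
Proof. by have := (tens_bilinear A B).1 b 1 a a'; rewrite /= !scale1r. Qed.

Lemma tensDr (a : A) (b b' : B) : a ⊗ (b + b') = a ⊗ b + a ⊗ b'.
Proof. by have := (tens_bilinear A B).2 a 1 b b'; rewrite /= !scale1r. Qed.

Lemma tens0l (b : B) : (0 : A) ⊗ b = 0.
Proof. by apply: (addIr ((0 : A) ⊗ b)); rewrite -tensDl !add0r. Qed.

Lemma tens0r (a : A) : a ⊗ (0 : B) = 0.
Proof. by apply: (addIr (a ⊗ (0 : B))); rewrite -tensDr !add0r. Qed.

Lemma tensZl (c : K) (a : A) (b : B) : (c *: a) ⊗ b = c *: (a ⊗ b).
Proof. by have := (tens_bilinear A B).1 b c a 0; rewrite /= tens0l !addr0. Qed.

Lemma tensZr (c : K) (a : A) (b : B) : a ⊗ (c *: b) = c *: (a ⊗ b).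
Proof. by have := (tens_bilinear A B).2 a c b 0; rewrite /= tens0r !addr0. Qed.

Lemma tensNl (a : A) (b : B) : (- a) ⊗ b = - (a ⊗ b).
Proof. by rewrite -scaleN1r tensZl scaleN1r. Qed.

Lemma tensNr (a : A) (b : B) : a ⊗ (- b) = - (a ⊗ b).
Proof. by rewrite -scaleN1r tensZr scaleN1r. Qed.

Lemma prod_tens (I : Type) (s : seq I) (c : I -> K) (a : I -> A) (b : I -> B) :
  \prod_(i <- s) (c i *: (a i ⊗ b i)) =
  (\prod_(i <- s) c i) *: ((\prod_(i <- s) a i) ⊗ (\prod_(i <- s) b i)).
Proof.
elim: s => [|i s IHs]; first by rewrite !big_nil scale1r.
by rewrite !big_cons IHs tensor_scalerAl tensor_scalerAr scalerA tensM.
Qed.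

Lemma tensor_sumZM (I J : finType) (a : I -> K) (b : J -> K) (X : I -> tensor A B)
    (Y : J -> tensor A B) :
  (\sum_i a i *: X i) * (\sum_j b j *: Y j) =
  \sum_(v : I * J) (a v.1 * b v.2) *: (X v.1 * Y v.2).
Proof.
rewrite mulr_suml -(pair_bigA _ (fun i j => (a i * b j) *: (X i * Y j))) /=.
apply: eq_bigr => i _; rewrite mulr_sumr; apply: eq_bigr => j _.
by rewrite tensor_scalerAl tensor_scalerAr scalerA.
Qed.

(** A tensor is the class of a finite list of pairs, hence a sum of pure tensors. *)
Lemma tensor_ind (P : tensor A B -> Prop) :
  P 0 -> (forall t u, P t -> P u -> P (t + u)) -> (forall a b, P (a ⊗ b)) ->
  forall t, P t.
Proof.
move=> P0 PD Pt t; rewrite -[t]generic_quotient.reprK -[X in P X]/(tproj _).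
elim: (generic_quotient.repr t) => [|[a b] s IHs]; first exact: P0.
suff -> : tproj ((a, b) :: s) = a ⊗ b + tproj s by apply: PD.
apply: tensorP => V f Hf; rewrite [RHS]tliftD // !tlift_proj //.
by rewrite /formal_eval !big_cons big_nil addr0.
Qed.

End TensorAlgebra.

Section TensorSwap.
Variables (K : comNzRingType) (A B : algType K).
Implicit Types (t u : tensor A B).

Fact tens_flip_bilinear : bilinear_for *:%R *:%R (fun (a : A) (b : B) => b ⊗ a).
Proof.
by split=> [b c a a'|a c b b'] /=; rewrite ?tensDr ?tensDl ?tensZl ?tensZr.
Qed.

Lemma tswap_tens (a : A) (b : B) : tswap (a ⊗ b) = b ⊗ a.
Proof. exact: (tlift_tens _ _ tens_flip_bilinear). Qed.

Fact tswap_linear : linear (@tswap K A B).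
Proof. exact: tlift_linear tens_flip_bilinear. Qed.

HB.instance Definition _ :=
  GRing.isLinear.Build K (tensor A B) (tensor B A) _ (@tswap K A B) tswap_linear.

Fact tswap_monoid_morphism : monoid_morphism (@tswap K A B).
Proof.
split=> [|t u]; first exact: tswap_tens.
elim/tensor_ind: t => [|t t' IHt IHt'|a b]; first by rewrite mul0r raddf0 mul0r.
  by rewrite mulrDl !raddfD /= IHt IHt' mulrDl.
elim/tensor_ind: u => [|u u' IHu IHu'|a' b']; first by rewrite mulr0 raddf0 mulr0.
  by rewrite mulrDr !raddfD /= IHu IHu' mulrDr.
by rewrite !(tensM, tswap_tens).
Qed.

HB.instance Definition _ :=
  GRing.isMonoidMorphism.Build (tensor A B) (tensor B A) (@tswap K A B)
    tswap_monoid_morphism.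

End TensorSwap.

(** * Powers with exponents in Z/n *)

Section ZpExponents.
Variables (T : pzRingType) (n : nat).

(** Indexing powers by a group allows sums over exponents to be translated; this is a homomorphism
    in [z] once [a ^+ n = 1]. *)
Definition zexp (a : T) (z : 'Z_n) : T := a ^+ (nat_of_ord z).

Hypothesis n_gt1 : (1 < n)%N.
Variable a : T.
Hypothesis a_n : a ^+ n = 1.
Implicit Types y z : 'Z_n.

Lemma zexp_nat (m : nat) : zexp a m%:R = a ^+ m.
Proof. by rewrite /zexp val_Zp_nat // expr_mod. Qed.

Lemma zexpD y z : zexp a (y + z) = zexp a y * zexp a z.
Proof. by rewrite -[X in X + z]natr_Zp -[X in _ + X]natr_Zp -natrD zexp_nat exprD. Qed.

Lemma zexpX z m : zexp a z ^+ m = zexp a (z * m%:R).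
Proof. by rewrite -[z in RHS]natr_Zp -natrM zexp_nat exprM. Qed.

Lemma zexp0 : zexp a 0 = 1.
Proof. by rewrite -[0]/(0%:R) zexp_nat. Qed.

Lemma zexpNK z : zexp a (- z) * zexp a z = 1.
Proof. by rewrite -zexpD addNr zexp0. Qed.

End ZpExponents.

Arguments zexp {T n} a z : simpl never.

Lemma sum_ordZp (V : nmodType) (n : nat) (g : nat -> V) : (1 < n)%N ->
  \sum_(i < n) g i = \sum_(i : 'Z_n) g i.
Proof.
by move=> n1; rewrite -(big_mkord xpredT) -[RHS](big_mkord xpredT) Zp_cast.
Qed.

Lemma mul_eq1r (K : fieldType) (T : algType K) (u v : T) : v = 1 -> u * v = u.
Proof. by move=> ->; rewrite mulr1. Qed.

(** * Commutation up to a scalar *)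

Section ScalarCommutation.
Variables (K : fieldType) (A : algType K).
Implicit Types (a b c : A).

(** The scalar may be zero: this is enough where the claim is that the integral vanishes. *)
Definition qcomm a b := exists s : K, a * b = s *: (b * a).

Lemma qcommM a b c : qcomm a b -> qcomm a c -> qcomm a (b * c).
Proof.
move=> [s ab] [t ac]; exists (s * t).
by rewrite mulrA ab -scalerAl -[b * a * c]mulrA ac -scalerAr scalerA mulrA.
Qed.

Lemma qcommMl a b c : qcomm a c -> qcomm b c -> qcomm (a * b) c.
Proof.
move=> [s ac] [t bc]; exists (s * t).
by rewrite -mulrA bc -scalerAr [a * (c * b)]mulrA ac -scalerAl scalerA -mulrA [t * s]mulrC.
Qed.

Lemma qcomm1 a : qcomm a 1.
Proof. by exists 1; rewrite mulr1 mul1r scale1r. Qed.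

Lemma qcomm1l a : qcomm 1 a.
Proof. by exists 1; rewrite mulr1 mul1r scale1r. Qed.

Lemma qcommX a b m : qcomm a b -> qcomm a (b ^+ m).
Proof.
move=> ab; elim: m => [|m IHm]; first exact: qcomm1.
by rewrite exprS; apply: qcommM.
Qed.

Lemma qcommXl a b m : qcomm a b -> qcomm (a ^+ m) b.
Proof.
move=> ab; elim: m => [|m IHm]; first exact: qcomm1l.
by rewrite exprS; apply: qcommMl.
Qed.

Lemma qcommN a b : a * b = - (b * a) -> qcomm a b.
Proof. by move=> ab; exists (-1); rewrite scaleN1r. Qed.

Lemma scale_commX a b (s : K) m :
  a * b = s *: (b * a) -> a ^+ m * b = s ^+ m *: (b * a ^+ m).
Proof.
move=> ab; elim: m => [|m IHm]; first by rewrite !expr0 mul1r mulr1 scale1r.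
rewrite exprS -[a * _ * b]mulrA IHm -scalerAr [a * (b * _)]mulrA ab -scalerAl scalerA.
by rewrite -[b * a * _]mulrA -exprSr.
Qed.

Lemma scale_commXX a b (s : K) m l :
  a * b = s *: (b * a) -> a ^+ m * b ^+ l = s ^+ (m * l) *: (b ^+ l * a ^+ m).
Proof.
move=> /(scale_commX m) ab; elim: l => [|l IHl].
  by rewrite muln0 !expr0 mul1r mulr1 scale1r.
rewrite exprS [a ^+ m * _]mulrA ab -scalerAl -[b * a ^+ m * _]mulrA IHl -scalerAr scalerA.
by rewrite [b * (_ * _)]mulrA mulnS exprD.
Qed.

(** Each new [b] moves past [a ^+ m] at the cost of a power of [s^-1]. The total is kept only as a
    nonzero scalar, which suffices for nonvanishing. *)
Lemma expr_scale_comm a b (s : K) m : s != 0 -> a * b = s *: (b * a) ->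
  exists2 u : K, u != 0 & (a * b) ^+ m = u *: (a ^+ m * b ^+ m).
Proof.
move=> s0 ab; elim: m => [|m [u u0 IHm]].
  by exists 1; rewrite ?oner_eq0 // !expr0 mulr1 scale1r.
exists (u * s^-1 ^+ m); first by rewrite mulf_neq0 // expf_neq0 // invr_neq0.
have sK : b * a ^+ m = s^-1 ^+ m *: (a ^+ m * b).
  by rewrite (scale_commX m ab) scalerA -exprMn mulVf // expr1n scale1r.
rewrite exprS IHm -scalerAr -[a * b * _]mulrA [b * (_ * _)]mulrA sK -scalerAl -scalerAr scalerA.
by rewrite !mulrA -exprS -[_ * b * _]mulrA -exprS.
Qed.

End ScalarCommutation.

(** * Character sums over Z/n *)

Section Characters.
Variables (K : fieldType) (n h : nat) (w : K).
Hypotheses (nE : n = h.*2) (h_gt0 : (0 < h)%N) (w_prim : n.-primitive_root w).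

Local Notation chi := (@zexp K n w).

Let n_gt1 : (1 < n)%N. Proof. by rewrite nE; case: (h) h_gt0 => // m; rewrite doubleS. Qed.
Let w_n : w ^+ n = 1. Proof. exact: prim_expr_order. Qed.

(** Shifting [b] by 1 multiplies the sum by [chi z], and primitivity of [w] gives [chi z != 1] for
    nonzero [z]. *)
Lemma chi_sum (z : 'Z_n) :
  \sum_(b : 'Z_n) chi (b * z) = if z == 0 then n%:R else 0.
Proof.
case: eqP => [->|/eqP z0].
  under eq_bigr do rewrite mulr0.
  by rewrite sumr_const zexp0 // card_ord Zp_cast.
have chi1 : chi z != 1.
  rewrite -(prim_order_dvd w_prim); apply: contra z0 => nz.
  by rewrite -[z]natr_Zp -val_eqE /= val_Zp_nat.
apply: (mulIf (x := chi z - 1)); first by rewrite subr_eq0.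
rewrite mul0r mulrBr mulr1 mulr_suml; apply/eqP; rewrite subr_eq0; apply/eqP.
rewrite [RHS](reindex_inj (addrI (1 : 'Z_n))); apply: eq_bigr => b _.
by rewrite mulrDl mul1r addrC zexpD.
Qed.

(** The solutions are 0 and [h], because [n] is twice [h]. *)
Lemma card_Zp_double0 :
  \sum_(d : 'Z_n) (if d + d == 0 then 1 else 0) = 2%:R :> K.
Proof.
rewrite -big_mkcond sumr_const; congr _%:R.
have h0 : (h%:R : 'Z_n) != 0.
  by rewrite -val_eqE /= val_Zp_nat // modn_small -?lt0n // nE -addnn -ltn_psubLR ?subnn.
transitivity #|[set (0 : 'Z_n); h%:R]|; last by rewrite cards2 eq_sym h0.
apply: eq_card => d; rewrite !inE.
apply/eqP/orP => [dd|[/eqP->|/eqP->]]; last 1 first.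
- by rewrite -natrD addnn -nE /= val_Zp_nat // modnn.
- have: (h * 2 %| d * 2)%N.
    by rewrite !muln2 -nE; move: dd; rewrite /= [X in (_ %% X)%N]Zp_cast // addnn => /eqP.
  rewrite dvdn_pmul2r // => /dvdnP[m dE].
  have: (m * h < 2 * h)%N by rewrite -dE mul2n -nE -[X in (_ < X)%N](Zp_cast n_gt1).
  rewrite ltn_pmul2r //; case: m dE => [|[|//]] dE _; [left|right].
    by apply/eqP/val_inj; rewrite /= dE.
  by rewrite -[d]natr_Zp dE mul1n.
- by rewrite addr0.
Qed.

(* The exponents of [K] in D * (F^t ⊗ E^t) * D * (E^t ⊗ F^t), t = n - 1, are
   u + v; the integral sees only u.1 + v.1 = 1 and u.2 + v.2 = -1. *)
Lemma chi_double_sum :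
  \sum_(u : 'Z_n * 'Z_n) \sum_(v : 'Z_n * 'Z_n)
    (if (u.1 + v.1 == 1) && (u.2 + v.2 == -1)
     then chi (- (u.1 * u.2)) * chi (- (v.1 * v.2)) * (chi (- v.1) * chi (v.2))
     else 0)
  = chi (-1) * n%:R * 2%:R.
Proof.
rewrite exchange_big /=.
(* Solving the constraints for [u] leaves an exponent that is affine in [v.1], with slope minus
   twice [1 + v.2]. *)
transitivity (\sum_(v : 'Z_n * 'Z_n) chi (1 + (v.2 + v.2) - v.1 * (1 + v.2 + (1 + v.2)))).
  apply: eq_bigr => v _.
  rewrite -big_mkcond (big_pred1 (1 - v.1, -1 - v.2)) => [|u] /=.
    by rewrite -!zexpD //; congr (zexp _ _); ring.
  case: u v => [u1 u2] [v1 v2] /=; rewrite xpair_eqE.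
  by rewrite [u1 == _]eq_sym [u2 == _]eq_sym !subr_eq [u1 + v1 == _]eq_sym [u2 + v2 == _]eq_sym.
rewrite -(pair_bigA _ (fun b c : 'Z_n => chi (1 + (c + c) - b * (1 + c + (1 + c))))) exchange_big /=.
(* The sum over [v.1] survives only where [1 + c] doubles to 0; the shift by 1 matches this with the
   count of such [d]. There [1 + (c + c)] equals -1. *)
rewrite -mulrA -card_Zp_double0 mulr_sumr mulr_sumr [RHS](reindex_inj (addrI (1 : 'Z_n))) /=.
apply: eq_bigr => c _.
under eq_bigr => b _ do rewrite -mulrN zexpD //.
rewrite -mulr_sumr chi_sum oppr_eq0; case: eqP => [c0|_]; last by rewrite !mulr0.
rewrite mulr1; congr (zexp _ _ * _); apply/eqP; rewrite -subr_eq0; apply/eqP.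
by rewrite -[RHS]c0; ring.
Qed.

End Characters.

(* [1 + b] and [1 - b] are orthogonal, and each squares to twice itself. *)
Lemma involution_pair_sqr (T : pzRingType) (b c : T) :
  b * b = 1 -> c * c = 1 -> b * c = c * b ->
  (1 + b + c - c * b) * (1 + b + c - c * b) = 4%:R.
Proof.
move=> b2 c2 bc.
have PP : (1 + b) * (1 + b) = (1 + b) *+ 2.
  by rewrite mulrDl mul1r mulrDr mulr1 b2 [b + 1]addrC mulr2n.
have QQ : (1 - b) * (1 - b) = (1 - b) *+ 2.
  by rewrite mulrBl mul1r mulrBr mulr1 b2 -[b - 1]opprB opprK mulr2n.
have PQ : (1 + b) * (1 - b) = 0.
  by rewrite mulrDl mul1r mulrBr mulr1 b2 [b - 1]addrC addrACA addrN addrC addNr addr0.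
have QP : (1 - b) * (1 + b) = 0.
  by rewrite mulrBl mul1r mulrDr mulr1 b2 [b + 1]addrC subrr.
have Pc : (1 + b) * c = c * (1 + b) by rewrite mulrDl mulrDr mul1r mulr1 bc.
have Qc : (1 - b) * c = c * (1 - b) by rewrite mulrBl mulrBr mul1r mulr1 bc.
have -> : 1 + b + c - c * b = (1 + b) + c * (1 - b) by rewrite mulrBr mulr1 addrA.
have PQ2 : (1 + b) *+ 2 + (1 - b) *+ 2 = 4%:R.
  by rewrite -mulrnDl addrCA addrK -mulr2n -mulrnA.
move: PP QQ PQ QP Pc Qc PQ2; move: (1 + b) (1 - b) => P Q PP QQ PQ QP Pc Qc <-.
rewrite mulrDl !mulrDr PP [P * (c * Q)]mulrA Pc -[c * P * Q]mulrA PQ mulr0 addr0.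
rewrite -[c * Q * P]mulrA QP mulr0 add0r; congr (_ + _).
by rewrite -[c * Q * _]mulrA [Q * (_ * _)]mulrA Qc -[c * Q * Q]mulrA QQ mulrA c2 mul1r.
Qed.

(** * Consequences of the defining relations for elements [x g] of any algebra *)

Section Realisation.
Variables (K : fieldType) (p r : nat) (q : K) (A : algType K) (x : gen p -> A).
Hypotheses (r_dvd8 : (8 %| r)%N) (q_prim : r.-primitive_root q).
Hypothesis x_rel : forall a b, uhg_rel r q x a b -> a = b.

Local Notation h := (r %/ 4)%N.
Local Notation n := r./2.
Local Notation t := r./2.-1.
Local Notation w := (q ^+ 2).
Local Notation k := (x GenK).
Local Notation e := (x GenE).
Local Notation f := (x GenF).
Local Notation L := (x GenL).
Local Notation Z s l := (x (GenZ s l)).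
Local Notation Lb := (k ^+ h * L).
Local Notation chi := (@zexp K r./2 w).
Local Notation kz := (@zexp A r./2 k).

Lemma r_quarter : exists2 m, (0 < m)%N & r = (8 * m)%N.
Proof.
have := prim_order_gt0 q_prim; case/dvdnP: r_dvd8 => m -> m0.
by exists m; [case: m m0 | rewrite mulnC].
Qed.

Lemma half_r : n = h.*2.
Proof. by have [m _ ->] := r_quarter; lia. Qed.

Lemma quarter_gt0 : (0 < h)%N.
Proof. by have [m m0 ->] := r_quarter; lia. Qed.

Lemma half_gt1 : (1 < n)%N.
Proof. by have [m m0 ->] := r_quarter; lia. Qed.

Lemma w_prim : n.-primitive_root w.
Proof.
have [m m0 rE] := r_quarter.
have -> : n = (r %/ gcdn 2 r)%N.
  have -> : gcdn 2 r = 2%N by apply/gcdn_idPl; rewrite rE; apply/dvdnP; exists (4 * m)%N; lia.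
  by rewrite divn2.
exact: exp_prim_root.
Qed.

Lemma w_n : w ^+ n = 1. Proof. exact: prim_expr_order w_prim. Qed.

Lemma w_neq0 : w != 0.
Proof. by rewrite (prim_root_eq0 w_prim) -lt0n ltnW // half_gt1. Qed.

(** The square of [w ^+ h] is [w ^+ n = 1], while [w ^+ h] itself is not 1 because [w] has order
    [n], twice [h]. *)
Lemma w_h : w ^+ h = -1.
Proof.
have /eqP : (w ^+ h) ^+ 2 = 1 by rewrite -exprM muln2 -half_r w_n.
rewrite sqrf_eq1 => /orP[/eqP wh1|/eqP //].
have : (n %| h)%N by rewrite (prim_order_dvd w_prim) wh1.
rewrite half_r => /dvdn_leq.
by have := quarter_gt0; lia.
Qed.

(** A primitive [r]-th root exists only if the divisors of [r] are nonzero in [K]. *)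
Lemma two_neq0 : 2%:R != 0 :> K.
Proof.
apply: (prim_root_dvd_eq0 q_prim).
by have [m _ ->] := r_quarter; apply/dvdnP; exists (4 * m)%N; lia.
Qed.

Lemma k_n : k ^+ n = 1. Proof. exact/x_rel/rel_KX. Qed.

Lemma kVk : k ^+ t * k = 1.
Proof. by rewrite -exprSr prednK ?k_n // ltnW // half_gt1. Qed.

Lemma k_e : k * e = w *: (e * k).
Proof. by rewrite -[k * e]mulr1 -kVk mulrA (x_rel (rel_KE _ _ _)) scalerAl. Qed.

Lemma f_k : f * k = w *: (k * f).
Proof.
apply: (scalerI (invr_neq0 w_neq0)); rewrite scalerA mulVf ?w_neq0 // scale1r.
by rewrite -[k * f]mulr1 -kVk mulrA (x_rel (rel_KF _ _ _)) scalerAl.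
Qed.

Lemma k_Z s l : k * Z s l = - (Z s l * k). Proof. exact/x_rel/rel_KZ. Qed.
Lemma e_Z s l : e * Z s l = - (Z s l * e). Proof. exact/x_rel/rel_EZ. Qed.
Lemma f_Z s l : f * Z s l = Z s l * f. Proof. exact/x_rel/rel_FZ. Qed.
Lemma L_Z s l : L * Z s l = - (Z s l * L). Proof. exact/x_rel/rel_LZ. Qed.
Lemma Z_Z s l s' l' : Z s l * Z s' l' = - (Z s' l' * Z s l).
Proof. exact/x_rel/rel_ZZ. Qed.
Lemma Z_sqr s l : Z s l * Z s l = 0. Proof. by rewrite -expr2; apply/x_rel/rel_ZX. Qed.
Lemma L_L : L * L = 1. Proof. by rewrite -expr2; apply/x_rel/rel_LX. Qed.
Lemma L_k : L * k = k * L. Proof. exact/x_rel/rel_LK. Qed.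
Lemma L_e : L * e = e * L. Proof. exact/x_rel/rel_LE. Qed.
Lemma L_f : L * f = f * L. Proof. exact/x_rel/rel_LF. Qed.

Lemma even_quarter : odd h = false.
Proof. by have [m _ ->] := r_quarter; lia. Qed.

Lemma kX_Z m s l : k ^+ m * Z s l = (-1) ^+ m *: (Z s l * k ^+ m).
Proof. by apply: scale_commX; rewrite k_Z scaleN1r. Qed.

(** Since 8 divides [r], the exponent [h] is even and [k ^+ h] commutes with [Z]; the sign is that
    of [L]. *)
Lemma Lb_Z s l : Lb * Z s l = - (Z s l * Lb).
Proof.
rewrite -mulrA L_Z mulrN [k ^+ h * (_ * L)]mulrA kX_Z -signr_odd even_quarter expr0 scale1r.
by rewrite mulrA.
Qed.

Lemma f_Lb : f * Lb = - (Lb * f).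
Proof.
rewrite mulrA -[f]expr1 (scale_commXX 1 h f_k) mul1n w_h scaleN1r expr1.
by rewrite mulNr -!mulrA L_f.
Qed.

Lemma L_kX m : L * k ^+ m = k ^+ m * L.
Proof. by apply: commrX; apply: L_k. Qed.

Lemma Lb_Lb : Lb * Lb = 1.
Proof.
by rewrite -mulrA [L * _]mulrA L_kX -[k ^+ h * L * L]mulrA L_L mulr1 -exprD addnn -half_r k_n.
Qed.

Lemma Lb_k : GRing.comm Lb k.
Proof. by rewrite /GRing.comm -mulrA L_k !mulrA -exprS -exprSr. Qed.

Lemma LbZ_LbZ s l s' l' : (Lb * Z s l) * (Lb * Z s' l') = - (Z s l * Z s' l').
Proof. by rewrite Lb_Z mulNr -[Z s l * _ * _]mulrA [Lb * (Lb * _)]mulrA Lb_Lb mul1r. Qed.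

(** * The summands in the exponent of the R-matrix *)

Variable alpha : 'I_p -> K.

Definition Zcoef (i : 'I_p * bool) : K := if i.2 then alpha i.1 else - alpha i.1.
Definition Zterm (i : 'I_p * bool) : tensor A A :=
  Zcoef i *: (Z i.2 i.1 ⊗ (Lb * Z (~~ i.2) i.1)).

(** Both legs anticommute, the second because the two [Lb] cancel up to sign; the two signs
    compensate. *)
Lemma Zterm_comm i j : GRing.comm (Zterm i) (Zterm j).
Proof.
rewrite /GRing.comm /Zterm !(tensor_scalerAl, tensor_scalerAr) scalerA scalerA mulrC.
congr (_ *: _); rewrite !tensM !LbZ_LbZ.
by rewrite [Z i.2 _ * _]Z_Z [Z (~~ i.2) _ * _]Z_Z tensNl !tensNr opprK.
Qed.

Lemma Zterm_sqr i : Zterm i * Zterm i = 0.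
Proof. by rewrite tensor_scalerAl tensor_scalerAr tensM Z_sqr tens0l !scaler0. Qed.

(** * The factors [R_z], [D] and Theta, and how they move past odd elements *)

Definition Rzx : tensor A A :=
  2%:R^-1 *: \sum_(v < 2) \sum_(u < 2) (-1) ^+ (v * u) *: (L ^+ u ⊗ L ^+ v).

Definition Dx : tensor A A :=
  n%:R^-1 *: \sum_(b < n) \sum_(c < n) q ^- (2 * b * c) *: (k ^+ b ⊗ k ^+ c).

(** The coefficients are kept arbitrary; of them only [th t] survives the integral. *)
Definition Thx (th : nat -> K) : tensor A A :=
  \sum_(a < n) th a *: (e ^+ a ⊗ f ^+ a).

Lemma RzxE : Rzx = 2%:R^-1 *: (1 ⊗ 1 + L ⊗ 1 + 1 ⊗ L - L ⊗ L).
Proof.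
rewrite /Rzx !big_ord_recl !big_ord0 /= !addr0 /bump /=.
by rewrite !(expr0, expr1, muln0, mul0n, scale1r) scaleN1r addrA.
Qed.

Lemma tswap_Rzx : tswap Rzx = Rzx.
Proof.
rewrite RzxE linearZ /=; congr (_ *: _).
by rewrite !raddfD raddfN /= !tswap_tens; congr (_ - _); rewrite addrAC.
Qed.

Lemma Rzx_sqr : Rzx * Rzx = 1.
Proof.
rewrite RzxE tensor_scalerAl tensor_scalerAr scalerA.
have -> : L ⊗ L = (1 ⊗ L) * (L ⊗ 1) by rewrite tensM mul1r mulr1.
rewrite (@involution_pair_sqr _ (L ⊗ 1) (1 ⊗ L)) ?tensM ?L_L ?mulr1 ?mul1r //.
rewrite -scaler_nat scalerA -invfM -natrM mulVf ?scale1r //.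
by rewrite (natrM _ 2 2) mulf_neq0 ?two_neq0.
Qed.

(** The coefficient depends on [b] and [c] only modulo [n], so the sum runs over a group and can be
    translated. *)
Lemma DxE : Dx = n%:R^-1 *:
  \sum_(u : 'Z_n * 'Z_n) chi (- (u.1 * u.2)) *: (kz u.1 ⊗ kz u.2).
Proof.
congr (_ *: _); rewrite -(pair_bigA _ (fun b c => chi (- (b * c)) *: (kz b ⊗ kz c))) /=.
rewrite (sum_ordZp (fun b => \sum_(c < n) q ^- (2 * b * c) *: (k ^+ b ⊗ k ^+ c)) half_gt1).
apply: eq_bigr => b _.
rewrite (sum_ordZp (fun c => q ^- (2 * b * c) *: (k ^+ b ⊗ k ^+ c)) half_gt1).
apply: eq_bigr => c _; congr (_ *: _).
have bc : chi (b * c) = q ^+ (2 * b * c).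
  rewrite -[X in zexp _ (X * _)]natr_Zp -[X in zexp _ (_ * X)]natr_Zp -natrM.
  by rewrite zexp_nat ?half_gt1 ?w_n // -exprM mulnA.
rewrite -bc; apply: mulr1_eq.
by rewrite mulrC zexpNK ?half_gt1 ?w_n.
Qed.

Lemma tswap_Dx : tswap Dx = Dx.
Proof.
rewrite /Dx linearZ linear_sum /=; congr (_ *: _).
under eq_bigr => b _ do rewrite linear_sum.
rewrite exchange_big; apply: eq_bigr => c _; apply: eq_bigr => b _.
by rewrite linearZ /= tswap_tens mulnAC.
Qed.

(** The sign from moving [kz b] past [z] is itself a value of [chi], since [w ^+ h = -1]; it can
    thus merge with the coefficients of [D]. *)
Lemma kz_odd z (b : 'Z_n) : k * z = - (z * k) -> kz b * z = chi (h%:R * b) *: (z * kz b).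
Proof.
move=> kz; rewrite (@scale_commX _ _ _ _ (-1)) ?kz ?scaleN1r //.
by rewrite mulrC -zexpX ?half_gt1 ?w_n // /zexp exprAC w_h.
Qed.

(** Translating both exponents by [h] absorbs the signs created by [z] and [z'] into the quadratic
    exponent. *)
Lemma Dx_odd z z' : k * z = - (z * k) -> k * z' = - (z' * k) ->
  Dx * (z ⊗ z') = (z ⊗ z') * ((k ^+ h ⊗ k ^+ h) * Dx).
Proof.
move=> kz1 kz2; rewrite DxE !tensor_scalerAr tensor_scalerAl; congr (_ *: _).
rewrite mulrA mulr_suml mulr_sumr.
rewrite (reindex_inj (addrI ((h%:R, h%:R) : 'Z_n * 'Z_n))) /=.
apply: eq_bigr => -[b c] _ /=.
rewrite tensor_scalerAl tensor_scalerAr !tensM (kz_odd _ kz1) (kz_odd _ kz2).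
have kzD d : kz (h%:R + d) = k ^+ h * kz d by rewrite zexpD ?zexp_nat ?half_gt1 ?k_n.
rewrite tensZl tensZr !scalerA -!zexpD ?half_gt1 ?w_n // !kzD !mulrA.
congr (zexp _ _ *: _).
(* The translation leaves the constant [h * h], a multiple of [n] because [h] is even. *)
have hh : h%:R * h%:R = 0 :> 'Z_n.
  rewrite -natrM; have -> : (h * h = n * h./2)%N.
    by rewrite half_r -{1}[h]odd_double_half even_quarter add0n; lia.
  by rewrite natrM pchar_Zp ?mul0r ?half_gt1.
by rewrite -[LHS]subr0 -hh; ring.
Qed.

(** Reversing the signs of [L ⊗ 1] and [1 ⊗ L] in [R_z] amounts to multiplying it by [- (L ⊗ L)]. *)
Lemma Rzx_odd z z' : L * z = - (z * L) -> L * z' = - (z' * L) ->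
  Rzx * (z ⊗ z') = - ((z * L) ⊗ (z' * L)) * Rzx.
Proof.
move=> Lz Lz'; rewrite RzxE tensor_scalerAl tensor_scalerAr; congr (_ *: _).
rewrite !(mulrDl, mulrDr, mulrN, mulNr, tensM, mul1r, mulr1) Lz Lz'.
rewrite -![_ * L * L]mulrA L_L !mulr1 !(tensNl, tensNr, opprK).
by rewrite [RHS](ACl (4*3*2*1)).
Qed.

Lemma Rzx_comm z z' : GRing.comm L z -> GRing.comm L z' -> GRing.comm Rzx (z ⊗ z').
Proof.
move=> Lz Lz'; rewrite /GRing.comm RzxE tensor_scalerAl tensor_scalerAr; congr (_ *: _).
by rewrite !(mulrDl, mulrDr, mulrN, mulNr, tensM, mul1r, mulr1) Lz Lz'.
Qed.

Lemma comm_scale (z : K) (u v : tensor A A) : GRing.comm u v -> GRing.comm u (z *: v).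
Proof. by move=> uv; rewrite /GRing.comm tensor_scalerAr uv tensor_scalerAl. Qed.

Lemma Rzx_Dx : GRing.comm Rzx Dx.
Proof.
rewrite DxE; apply: comm_scale; apply: commr_sum => u _; apply: comm_scale.
by apply: Rzx_comm; apply: commrX; apply: L_k.
Qed.

Lemma Rzx_tswap_Thx th : GRing.comm Rzx (tswap (Thx th)).
Proof.
rewrite linear_sum /=; apply: commr_sum => a _; rewrite linearZ /= tswap_tens.
by apply: comm_scale; apply: Rzx_comm; apply: commrX; [exact: L_f | exact: L_e].
Qed.

Lemma odd_LbZ s l : L * (Lb * Z s l) = - (Lb * Z s l * L) /\ k * (Lb * Z s l) = - (Lb * Z s l * k).
Proof.
split; rewrite mulrA.
  rewrite mulrA L_kX -[_ * L * L]mulrA -[_ * (L * L) * _]mulrA -[L * L * _]mulrA L_Z.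
  by rewrite !mulrN !mulrA.
by rewrite -Lb_k -[Lb * _ * _]mulrA k_Z mulrN !mulrA.
Qed.

(** The [k ^+ h] from [D] and the [L] from [R_z] make up [Lb] on each leg, which carries the [Lb] of
    the term to the other leg. The sign in [Rzx_odd] matches the opposite coefficients of the two
    terms. *)
Lemma tswap_Zterm i : tswap (Zterm i) * (Rzx * Dx) = (Rzx * Dx) * Zterm (i.1, ~~ i.2).
Proof.
have ZcoefN : Zcoef (i.1, ~~ i.2) = - Zcoef i by rewrite /Zcoef /=; case: (i.2); rewrite ?opprK.
case: i ZcoefN => l s /= ZcoefN; rewrite /Zterm linearZ /= tswap_tens negbK ZcoefN.
rewrite tensor_scalerAl (tensor_scalerAr _ (Rzx * Dx)) scaleNr -scalerN; congr (_ *: _).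
have [LZ kZ] := odd_LbZ s l.
rewrite -[Rzx * Dx * _]mulrA Dx_odd ?k_Z // [Rzx * (_ * _)]mulrA Rzx_odd ?L_Z //.
rewrite -[_ * Rzx * _]mulrA [Rzx * (_ * Dx)]mulrA.
rewrite (Rzx_comm (L_kX h) (L_kX h)) -[_ * Rzx * Dx]mulrA [in RHS]mulrA mulNr tensM.
rewrite -!mulNr opprK -![_ * L * k ^+ h]mulrA L_kX.
by rewrite !Lb_Z mulNr -[Z s l * Lb * Lb]mulrA Lb_Lb mulr1 tensNl tensNr.
Qed.

(** [e] anticommutes with [Z], and [f] with [Lb * Z], so the a-th summand produces the sign
    [(-1) ^+ a] twice. *)
Lemma Thx_Zterm th i : GRing.comm (Zterm i) (Thx th).
Proof.
rewrite /Zterm; apply/commr_sym/comm_scale/commr_sym; apply: commr_sum => a _.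
apply: comm_scale; rewrite /GRing.comm !tensM.
have fLZ : f * (Lb * Z (~~ i.2) i.1) = -1 *: (Lb * Z (~~ i.2) i.1 * f).
  by rewrite mulrA f_Lb mulNr -[Lb * f * _]mulrA f_Z mulrA scaleN1r.
have eZ : e * Z i.2 i.1 = -1 *: (Z i.2 i.1 * e) by rewrite e_Z scaleN1r.
rewrite (scale_commX a fLZ) (scale_commX a eZ) tensZl tensZr scalerA -exprMn.
by rewrite mulrNN mulr1 expr1n scale1r.
Qed.

(** * The monodromy of the R-matrix *)

Definition Rx th : tensor A A := Rzx * Dx * Thx th * formal_exp Zterm.

Lemma monodromy_Rx th : tswap (Rx th) * Rx th =
  Dx * tswap (Thx th) * Dx * Thx th * formal_exp (fun i => Zterm i *+ 2).
Proof.
have termC i j : GRing.comm (1 + Zterm i) (1 + Zterm j).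
  apply: commrD; first exact: commr1.
  by apply/commr_sym; apply: commrD; [exact: commr1 | exact: Zterm_comm].
have swapE : tswap (formal_exp Zterm) * (Rzx * Dx) = Rzx * Dx * formal_exp Zterm.
  rewrite !formal_expE rmorph_prod /=.
  rewrite (@prod_intertwine _ _ _ _ (fun i => 1 + Zterm (i.1, ~~ i.2))); last first.
    by move=> i; rewrite rmorphD rmorph1 mulrDl mulrDr mul1r mulr1 tswap_Zterm.
  (* Flipping the sign in each index only permutes the factors, and these commute. *)
  congr (_ * _); rewrite -(big_map (fun i : 'I_p * bool => (i.1, ~~ i.2)) xpredT (fun i => 1 + Zterm i)).
  apply: perm_prod_comm => //; apply: uniq_perm.
  - rewrite map_inj_uniq ?index_enum_uniq //.
    by move=> [l s] [l' s'] [-> /negb_inj->].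
  - exact: index_enum_uniq.
  move=> [l s]; rewrite mem_index_enum; apply/mapP.
  by exists (l, ~~ s); rewrite ?mem_index_enum //= negbK.
have expTh : GRing.comm (Thx th) (formal_exp Zterm).
  rewrite formal_expE; apply: commr_prod => i _.
  by apply: commrD; [exact: commr1 | apply/commr_sym/Thx_Zterm].
rewrite -(formal_exp_sqr Zterm_comm Zterm_sqr) /Rx !rmorphM /= tswap_Rzx tswap_Dx.
set Ey := formal_exp Zterm in swapE expTh *; set T := Thx th in expTh *.
have RT : GRing.comm Rzx (tswap T) by exact: Rzx_tswap_Thx.
have RD := Rzx_Dx.
(* Regrouped so that [swapE] applies; afterwards the two [Rzx] are brought together and cancel. *)
rewrite -!mulrA; transitivity (Rzx * (Dx * (tswap T * ((tswap Ey * (Rzx * Dx)) * (T * Ey))))).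
  by rewrite -!mulrA.
rewrite swapE -!mulrA [Ey * (T * _)]mulrA -expTh -!mulrA.
rewrite [tswap T * (Rzx * _)]mulrA -RT -!mulrA [Dx * (Rzx * _)]mulrA -RD -!mulrA.
by rewrite [Rzx * (Rzx * _)]mulrA Rzx_sqr mul1r.
Qed.

(** * Evaluating the antipode and the integral on the two legs *)

Local Notation P := (\prod_(l < p) (Z true l * Z false l)).

Variables (lam : {scalar A}) (S : {linear A -> A}) (ltop : K).
Hypotheses (S1 : S 1 = 1) (SM : forall a b, S (a * b) = S b * S a).
Hypotheses (S_k : S k = k ^+ t) (S_e : S e = - (e * k ^+ t)) (S_f : S f = - (k * f)).
Hypothesis S_Z : forall s l, S (Z s l) = - (Z s l * Lb).
Hypothesis lam_basis : forall a b c d, (a < n)%N -> (b < n)%N -> (c < n)%N -> (d < 2)%N ->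
  forall g g' : 'I_p -> bool,
  lam (e ^+ a * f ^+ b * k ^+ c * L ^+ d *
    \prod_(l < p) (Z true l ^+ g l * Z false l ^+ g' l)) =
  if [&& a == t, b == t, c == t, d == 0 & [forall l, g l && g' l]] then ltop else 0.

Definition ev (m : tensor A A) : K^o := tlift (fun a b => lam (S a) * lam b : K^o) m.

Fact ev_bilinear : bilinear_for *:%R *:%R (fun a b => lam (S a) * lam b : K^o).
Proof.
split=> [b c a a'|a c b b'] /=.
  by rewrite !linearP /= mulrDl -mulrA.
by rewrite linearP /= mulrDr mulrCA.
Qed.

HB.instance Definition _ :=
  GRing.isLinear.Build K (tensor A A) K^o _ ev (tlift_linear ev_bilinear).

Lemma ev_tens a b : ev (a ⊗ b) = lam (S a) * lam b.
Proof. exact: (tlift_tens _ _ ev_bilinear). Qed.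

Lemma t_lt : (t < n)%N. Proof. by rewrite ltn_predL ltnW ?half_gt1. Qed.

(** Turns the scalars from moving [K] past the top powers of [e] and [f] into values of [chi]. *)
Lemma natr_t : (t%:R : 'Z_n) = -1.
Proof.
apply/eqP; rewrite -addr_eq0 natr1 prednK; last by rewrite ltnW ?half_gt1.
by rewrite pchar_Zp ?half_gt1.
Qed.

Lemma eq_t (z : 'Z_n) : (nat_of_ord z == t) = (z == -1).
Proof.
by rewrite -natr_t -[RHS]val_eqE /= val_Zp_nat ?half_gt1 // modn_small ?t_lt.
Qed.

Lemma kz_et z : kz z * e ^+ t = chi (- z) *: (e ^+ t * kz z).
Proof.
rewrite (scale_commXX _ _ k_e); congr (_ *: _).
by rewrite exprM -/(zexp w z) zexpX ?half_gt1 ?w_n // natr_t mulrN1.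
Qed.

Lemma ft_kz z : f ^+ t * kz z = chi (- z) *: (kz z * f ^+ t).
Proof.
rewrite (scale_commXX _ _ f_k); congr (_ *: _).
by rewrite mulnC exprM -/(zexp w z) zexpX ?half_gt1 ?w_n // natr_t mulrN1.
Qed.

Lemma kz_ft z : kz z * f ^+ t = chi z *: (f ^+ t * kz z).
Proof. by rewrite ft_kz scalerA mulrC zexpNK ?half_gt1 ?w_n // scale1r. Qed.

Lemma kzD y1 y2 : kz (y1 + y2) = kz y1 * kz y2.
Proof. by rewrite zexpD ?half_gt1 ?k_n. Qed.

(** The [Z] come in pairs, so the signs cancel; the same holds for [e]. *)
Lemma k_P : GRing.comm k P.
Proof.
apply: commr_prod => l _.
by rewrite /GRing.comm mulrA k_Z mulNr -[Z true l * k * _]mulrA k_Z mulrN opprK mulrA.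
Qed.

Lemma e_P : GRing.comm e P.
Proof.
apply: commr_prod => l _.
by rewrite /GRing.comm mulrA e_Z mulNr -[Z true l * e * _]mulrA e_Z mulrN opprK mulrA.
Qed.

Lemma f_P : GRing.comm f P.
Proof. by apply: commr_prod => l _; apply: commrM; apply: f_Z. Qed.

Lemma S_X a m : S (a ^+ m) = S a ^+ m.
Proof. by elim: m => [|m IHm]; rewrite ?expr0 ?S1 // exprS exprSr SM IHm. Qed.

Lemma S_kz z : S (kz z) = kz (- z).
Proof.
rewrite S_X S_k -exprM mulnC exprM -/(zexp k z).
by rewrite zexpX ?half_gt1 ?k_n // natr_t mulrN1.
Qed.

Lemma ZZ_comm l l' : GRing.comm (Z true l * Z false l) (Z true l' * Z false l').
Proof.
have ZZZ s : Z s l' * (Z true l * Z false l) = Z true l * Z false l * Z s l'.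
  by rewrite mulrA Z_Z mulNr -[Z true l * Z s l' * _]mulrA [Z s l' * _]Z_Z mulrN opprK mulrA.
by apply: commrM; apply: commr_sym; rewrite /GRing.comm ZZZ.
Qed.

(** Reversing the two [Z] costs a sign, moving one [Lb] past a [Z] costs another, and the two [Lb]
    cancel. *)
Lemma S_ZZ l : S (Z true l * Z false l) = Z true l * Z false l.
Proof.
rewrite SM !S_Z mulrNN -[Z true l * Lb]opprK -Lb_Z mulrN -[_ * Lb * _]mulrA.
by rewrite [Lb * (Lb * _)]mulrA Lb_Lb mul1r Z_Z opprK.
Qed.

Lemma S_P : S P = P.
Proof.
elim: (index_enum _) => [|l s IHs]; first by rewrite !big_nil S1.
rewrite !big_cons SM IHs S_ZZ; apply/esym/commr_prod => l' _; exact: ZZ_comm.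
Qed.

Lemma S_et_ft : exists2 u : K, u != 0 & S e ^+ t * S f ^+ t = u *: (e ^+ t * f ^+ t).
Proof.
have ekt : e * k ^+ t = (w ^+ t)^-1 *: (k ^+ t * e).
  by rewrite (scale_commX t k_e) scalerA mulVf ?scale1r // expf_neq0 // w_neq0.
have kf : k * f = w^-1 *: (f * k).
  by rewrite f_k scalerA mulVf ?scale1r // w_neq0.
have [u u0 uE] := expr_scale_comm t (invr_neq0 (expf_neq0 t w_neq0)) ekt.
have [v v0 vE] := expr_scale_comm t (invr_neq0 w_neq0) kf.
exists (u * v); first exact: mulf_neq0.
rewrite S_e S_f -[- (e * _)]scaleN1r -[- (k * f)]scaleN1r !exprZn uE vE.
(* The powers of [k] from the two antipodes meet between [e ^+ t] and [f ^+ t] and cancel there. *)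
have kVk_t : (k ^+ t) ^+ t * k ^+ t = 1.
  rewrite -exprMn_comm ?kVk ?expr1n //.
  by apply/commr_sym/commrX.
rewrite !(=^~ scalerAl, =^~ scalerAr) !scalerA -[e ^+ t * _ * _]mulrA [_ ^+ t * (k ^+ t * _)]mulrA.
rewrite kVk_t mul1r; congr (_ *: _).
have s1 : (-1) ^+ t * (-1) ^+ t = 1 :> K by rewrite -exprMn mulrNN mulr1 expr1n.
move: s1; move: ((-1) ^+ t : K) => s s1.
by rewrite -[RHS]mul1r -[X in X * (u * v)]s1; ring.
Qed.

Lemma evZ (c : K) m : ev (c *: m) = c * ev m.
Proof. exact: linearZ. Qed.

Lemma lamZ (c : K) v : lam (c *: v) = c * lam v.
Proof. exact: linearZ. Qed.

Lemma S_scale (c : K) v : S (c *: v) = c *: S v.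
Proof. exact: linearZ. Qed.

(** The antipode inverts [K] on the first leg: the integral's exponent -1 becomes the condition
    [b + b' == 1] there, and [c + c' == -1] on the second leg. *)
Lemma ev_top (b b' c c' : 'Z_n) (u C : K) :
  S e ^+ t * S f ^+ t = u *: (e ^+ t * f ^+ t) ->
  ev ((kz b ⊗ kz c) * (f ^+ t ⊗ e ^+ t) * (kz b' ⊗ kz c') * (e ^+ t ⊗ f ^+ t) *
      (C *: (P ⊗ P))) =
  C * (chi (- b') * chi c') *
    (u * (if b + b' == 1 then ltop else 0) * (if c + c' == -1 then ltop else 0)).
Proof.
move=> uE.
have lam_top z : lam (e ^+ t * f ^+ t * kz z * P) = if z == -1 then ltop else 0.
  have zn : (z < n)%N by rewrite -[X in (_ < X)%N](Zp_cast half_gt1).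
  have allT : [forall l : 'I_p, xpredT l && xpredT l] by apply/forallP.
  have := lam_basis t_lt t_lt zn (isT : (0 < 2)%N) xpredT xpredT.
  by rewrite allT expr0 mulr1 !eqxx eq_t /= andbT.
(* Powers of [K] are gathered on the left, before [f] and [e], so that the order-reversing antipode
   yields the basis order. *)
have first_tens : kz b * f ^+ t * kz b' * e ^+ t * P =
    chi (- b') *: (kz (b + b') * f ^+ t * e ^+ t * P).
  rewrite -[kz b * _ * kz b']mulrA ft_kz -scalerAr -!scalerAl; congr (_ *: _).
  by rewrite kzD !mulrA.
have second_tens : kz c * e ^+ t * kz c' * f ^+ t * P =
    chi c' *: (e ^+ t * f ^+ t * kz (c + c') * P).
  rewrite kz_et -!scalerAl -[e ^+ t * _ * kz c']mulrA -kzD -[e ^+ t * _ * f ^+ t]mulrA kz_ft.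
  rewrite -scalerAr -scalerAl scalerA -zexpD ?half_gt1 ?w_n //.
  by rewrite addrA addNr add0r !mulrA.
have SefP : S (kz (b + b') * f ^+ t * e ^+ t * P) =
    u *: (e ^+ t * f ^+ t * kz (- (b + b')) * P).
  rewrite !SM S_P S_kz !S_X [S e ^+ t * _]mulrA uE -scalerAl -scalerAr; congr (_ *: _).
  have P_comm : GRing.comm P (e ^+ t * f ^+ t * kz (- (b + b'))).
    apply: commrM; last by apply/commrX/commr_sym/k_P.
    by apply: commrM; apply/commrX/commr_sym; [apply: e_P | apply: f_P].
  by rewrite -P_comm !mulrA.
rewrite tensor_scalerAr !tensM evZ ev_tens first_tens second_tens S_scale SefP !lamZ.
rewrite !lam_top eqr_opp. 
move: (zexp w _) (zexp w _) (if b + b' == 1 then ltop else 0) (if c + c' == -1 then ltop else 0).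
by move=> c1 c2 l1 l2; ring.
Qed.

(** All reorderings cost only scalars, so the argument is a multiple of a basis element with the
    same exponents of [e], [f] and [Z]; the integral vanishes there whatever the powers of [K] and
    [L]. *)
Lemma lam_vanish (c c' : 'Z_n) (a a' : nat) (g g' : 'I_p -> bool) :
  (a < n)%N -> (a' < n)%N ->
  ~~ [&& a == t, a' == t & [forall l, g l && g' l]] ->
  lam (kz c * e ^+ a * kz c' * f ^+ a' *
    \prod_(l < p) ((Lb * Z false l) ^+ g l * (Lb * Z true l) ^+ g' l)) = 0.
Proof.
move=> an a'n top.
have k_qe : qcomm k e by exists w; exact: k_e.
have k_qf : qcomm k f by exists w^-1; rewrite f_k scalerA mulVf ?scale1r ?w_neq0.
have L2 : L ^+ 2 = 1 by rewrite expr2 L_L.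
have lam0 N M : lam (e ^+ a * f ^+ a' * k ^+ N * L ^+ M *
    \prod_(l < p) (Z true l ^+ g' l * Z false l ^+ g l)) = 0.
  rewrite -(expr_mod N k_n) -(expr_mod M L2) lam_basis ?ltn_mod //; last exact: ltnW half_gt1.
  case: ifP => // /and5P[at_ a't_ _ _ gg]; case/negP: top.
  by rewrite at_ a't_; apply/forallP => l; rewrite andbC; exact: (forallP gg).
(* The [Lb] are pulled to the left and the two [Z] of each [l] are put in basis order. *)
have [s [M ->]] : exists s M, \prod_(l < p) ((Lb * Z false l) ^+ g l * (Lb * Z true l) ^+ g' l)
    = s *: (Lb ^+ M * \prod_(l < p) (Z true l ^+ g' l * Z false l ^+ g l)).
  elim: (index_enum _) => [|l js [s [M IHs]]].
    by exists 1, 0%N; rewrite !big_nil mulr1 scale1r.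
  rewrite !big_cons IHs.
  have [s1 [M1 ->]] : exists s1 M1, (Lb * Z false l) ^+ g l * (Lb * Z true l) ^+ g' l =
      s1 *: (Lb ^+ M1 * (Z true l ^+ g' l * Z false l ^+ g l)).
    case: (g l); case: (g' l); rewrite ?expr1 ?expr0 ?mulr1 ?mul1r.
    - by exists 1, 0%N; rewrite LbZ_LbZ Z_Z opprK scale1r mul1r.
    - by exists 1, 1%N; rewrite scale1r.
    - by exists 1, 1%N; rewrite scale1r.
    - by exists 1, 0%N; rewrite scale1r !mulr1.
  have Lb_q s' : qcomm (Z s' l) Lb by apply: qcommN; rewrite Lb_Z opprK.
  have [s2 s2E] : qcomm (Z true l ^+ g' l * Z false l ^+ g l) (Lb ^+ M).
    by apply: qcommX; apply: qcommMl; apply: qcommXl.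
  exists (s1 * s * s2), (M1 + M)%N.
  rewrite -scalerAl -scalerAr scalerA -[Lb ^+ M1 * _ * _]mulrA [_ * (Lb ^+ M * _)]mulrA s2E.
  by rewrite -!scalerAl -!scalerAr scalerA exprD !mulrA.
have [s1 s1E] : qcomm (kz c) (e ^+ a) by apply: qcommX; apply: qcommXl.
have [s2 s2E] : qcomm (kz c * kz c') (f ^+ a').
  by apply: qcommX; apply: qcommMl; apply: qcommXl.
rewrite s1E -!scalerAl -!scalerAr -[e ^+ a * kz c * _]mulrA -[e ^+ a * _ * f ^+ a']mulrA s2E.
rewrite -!scalerAr -!scalerAl exprMn_comm; last by apply/commr_sym/commrX/L_k.
rewrite -exprM -exprD ![lam (_ *: _)]linearZ /=.
have := lam0 (c + c' + h * M)%N M.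
by rewrite [k ^+ (_ + h * M)]exprD exprM !mulrA => ->; rewrite !mulr0.
Qed.

Definition Zcoef_in (J : {set 'I_p * bool}) (i : 'I_p * bool) : K :=
  if i \in J then Zcoef i *+ 2 else 1.

(** Indices outside [J] contribute 1, so the product runs over all pairs; the commuting factors are
    then listed with the two signs of each [l] adjacent, as in the basis. *)
Lemma prod_Zterm (J : {set 'I_p * bool}) :
  \prod_(i in J) (Zterm i *+ 2) =
  (\prod_(l < p) (Zcoef_in J (l, true) * Zcoef_in J (l, false))) *:
  ((\prod_(l < p) (Z true l ^+ ((l, true) \in J) * Z false l ^+ ((l, false) \in J))) ⊗
   (\prod_(l < p) ((Lb * Z false l) ^+ ((l, true) \in J) * (Lb * Z true l) ^+ ((l, false) \in J)))).
Proof.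
pose fact i : tensor A A := Zcoef_in J i *: (Z i.2 i.1 ^+ (i \in J) ⊗ (Lb * Z (~~ i.2) i.1) ^+ (i \in J)).
have factE i : fact i = if i \in J then Zterm i *+ 2 else 1.
  by rewrite /fact /Zcoef_in; case: (i \in J); rewrite ?expr1 ?expr0 ?scale1r // scalerMnl.
have factC i j : GRing.comm (fact i) (fact j).
  rewrite !factE; case: ifP => _; case: ifP => _; try exact: commr1; last exact/commr_sym/commr1.
  by apply: commrMn; apply/commr_sym/commrMn; exact: Zterm_comm.
rewrite big_mkcond -prod_tens; under eq_bigr => i _ do rewrite -factE.
rewrite (@perm_prod_comm _ _ _ [seq (l, s) | l <- index_enum 'I_p, s <- [:: true; false]]) //.
  rewrite big_allpairs_dep /=; apply: eq_bigr => l _.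
  by rewrite !big_cons big_nil mulr1 /fact tensor_scalerAl tensor_scalerAr scalerA tensM.
apply: uniq_perm; first exact: index_enum_uniq.
  by rewrite allpairs_uniq ?index_enum_uniq // => -[? ?] [? ?].
move=> [l s]; rewrite mem_index_enum; apply/esym/allpairsP.
by exists (l, s); rewrite mem_index_enum; case: s.
Qed.

(** Each copy of Theta contributes [th t], each integral [ltop], the exponential one factor per [l];
    all other scalars are gathered in [u]. *)
Lemma ev_monodromy th : exists2 u : K, u != 0 &
  ev (tswap (Rx th) * Rx th) =
  u * th t ^+ 2 * ltop ^+ 2 * \prod_(l < p) (- (alpha l *+ 2) ^+ 2).
Proof.
have [s s0 sE] := S_et_ft.
have [n1 wn] := (half_gt1, w_n).
pose o : 'I_n := Ordinal t_lt.
pose tensD (u : 'Z_n * 'Z_n) : tensor A A := kz u.1 ⊗ kz u.2.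
pose coefD (u : 'Z_n * 'Z_n) : K := chi (- (u.1 * u.2)).
(* The components of [v] are the exponents in the first [D], the swapped Theta, the second [D] and
   Theta, then a subset from the exponential. *)
pose TT (v : 'Z_n * 'Z_n * 'I_n * ('Z_n * 'Z_n) * 'I_n * {set 'I_p * bool}) : tensor A A :=
  tensD v.1.1.1.1 * (f ^+ v.1.1.1.2 ⊗ e ^+ v.1.1.1.2) *
  tensD v.1.1.2 * (e ^+ v.1.2 ⊗ f ^+ v.1.2) * \prod_(i in v.2) (Zterm i *+ 2).
pose cc (v : 'Z_n * 'Z_n * 'I_n * ('Z_n * 'Z_n) * 'I_n * {set 'I_p * bool}) : K :=
  coefD v.1.1.1.1 * th v.1.1.1.2 * coefD v.1.1.2 * th v.1.2 * 1.
have expand : tswap (Rx th) * Rx th = (n%:R^-1 * n%:R^-1) *: \sum_v cc v *: TT v.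
  have swapTh : tswap (Thx th) = \sum_(a < n) th a *: (f ^+ a ⊗ e ^+ a).
    by rewrite linear_sum; apply: eq_bigr => a _; rewrite linearZ /= tswap_tens.
  have expE : formal_exp (fun i => Zterm i *+ 2) =
      \sum_(J : {set 'I_p * bool}) 1%R *: \prod_(i in J) (Zterm i *+ 2).
    by apply: eq_bigr => J _; rewrite scale1r.
  rewrite monodromy_Rx swapTh expE DxE /Thx.
  rewrite !(tensor_scalerAl, tensor_scalerAr) scalerA; congr (_ *: _).
  by rewrite !tensor_sumZM.
have evTT v : ev (cc v *: TT v) = cc v * ev (TT v) by exact: evZ.
(* The vanishing is read off the second leg. *)
have TT0 v : ~~ [&& v.1.1.1.2 == o, v.1.2 == o & v.2 == setT] -> ev (TT v) = 0.
  move=> top; rewrite /TT prod_Zterm tensor_scalerAr evZ !tensM ev_tens lam_vanish ?mulr0 //.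
  apply: contra top => /and3P[ao a'o /forallP full].
  rewrite -[v.1.1.1.2 == o]val_eqE -[v.1.2 == o]val_eqE ao a'o; apply/eqP/setP => -[l b]; rewrite inE.
  by have /andP[] := full l; case: b.
have TTtop u u' : ev (TT (u, o, u', o, setT)) =
    (\prod_(l < p) (- (alpha l *+ 2) ^+ 2)) * (chi (- u'.1) * chi u'.2) *
    (s * (if u.1 + u'.1 == 1 then ltop else 0) * (if u.2 + u'.2 == -1 then ltop else 0)).
  rewrite -ev_top // /TT prod_Zterm /=; congr (ev (_ * (_ *: (_ ⊗ _)))).
  (* The two signs of [l] contribute [alpha l *+ 2] and its opposite. *)
  - by apply: eq_bigr => l _; rewrite /Zcoef_in !inE /Zcoef /= mulNrn mulrN expr2.
  - by apply: eq_bigr => l _; rewrite !inE !expr1.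
  - by apply: eq_bigr => l _; rewrite !inE !expr1 LbZ_LbZ Z_Z opprK.
(* [s] comes from the antipode of the top powers, the inverses of [n] from the two [D], the rest
   from [chi_double_sum]. *)
exists (s * ((n%:R^-1 * n%:R^-1) * (chi (-1) * n%:R * 2%:R))).
  have n0 : n%:R != 0 :> K by exact: prim_root_natf_neq0 w_prim.
  by rewrite !mulf_neq0 ?invr_neq0 ?two_neq0 // expf_neq0 ?w_neq0.
rewrite expand evZ linear_sum /=; under eq_bigr => v _ do rewrite evTT.
(* The subset and both Theta exponents collapse in turn, leaving the double sum over the exponents
   of the two [D]. *)
rewrite (sum_pair_only (j0 := setT)); last first.
  by move=> v J JT; rewrite TT0 ?mulr0 //= (negPf JT) !andbF.
rewrite (sum_pair_only (j0 := o)); last first.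
  by move=> v a ao; rewrite TT0 ?mulr0 //= (negPf ao) !andbF.
rewrite -(pair_bigA _ (fun ua u' => cc (ua, u', o, setT) * ev (TT (ua, u', o, setT)))) exchange_big /=.
under eq_bigr => u' _.
  rewrite (sum_pair_only (j0 := o)); last first.
    by move=> v a ao; rewrite TT0 ?mulr0 //= (negPf ao).
  over.
rewrite exchange_big /= -(chi_double_sum half_r quarter_gt0 w_prim).
rewrite !(mulr_sumr, mulr_suml); apply: eq_bigr => u _.
rewrite !(mulr_sumr, mulr_suml); apply: eq_bigr => u' _.
rewrite TTtop /cc /coefD /=; case: eqP => _; case: eqP => _; rewrite ?(mulr0, mul0r) //=.
move: (zexp w _) (zexp w _) (zexp w _) (zexp w _) (\prod_(l < p) _) (n%:R^-1) => c1 c2 c3 c4 c5 c6.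
ring.
Qed.

End Realisation.

(** * Nonvanishing of quantum numbers *)

Section QuantumNumbersNonzero.
Variables (K : fieldType) (r : nat) (q : K).
Hypotheses (r_dvd8 : (8 %| r)%N) (q_prim : r.-primitive_root q).

(** A zero would give [q ^+ (2 * i) = 1] with [2 * i] positive and below the order [r]. *)
Lemma qbrace_neq0 i : (0 < i < r./2)%N -> qbrace q i != 0.
Proof.
case/andP=> i0 ir; have q0 : q != 0 by rewrite (prim_root_eq0 q_prim) -lt0n (prim_order_gt0 q_prim).
rewrite /qbrace subr_eq0; apply/eqP => qi.
have : q ^+ (2 * i) == 1.
  by rewrite mul2n -addnn exprD {2}qi mulfV // expf_neq0.
rewrite -(prim_order_dvd q_prim) => /dvdn_leq; lia.
Qed.

Lemma qfact_neq0 m : (m < r./2)%N -> qfact q m != 0.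
Proof.
move=> mr; rewrite /qfact big_nat prodf_seq_neq0; apply/allP => i _ /=.
apply/implyP => /andP[i0 im]; rewrite mulf_neq0 ?invr_neq0 // qbrace_neq0 //; first lia.
by have := half_gt1 r_dvd8 q_prim; lia.
Qed.

End QuantumNumbersNonzero.

(** * Relations in the quotient algebra, and the conclusion *)

Ltac push_morph :=
  rewrite ?(linearZ_LR, rmorphB, rmorphM, rmorphXn, rmorphN, rmorph1, rmorph0).

(** Each relation has the same shape after applying an algebra map. For the projection from the free
    algebra, this shows that the generators of [uhg] form a realisation. *)
Lemma uhg_rel_morph (K : fieldType) (p r : nat) (q : K) (F B : algType K)
    (x : gen p -> F) (phi : {lrmorphism F -> B}) (a b : B) :
  (forall a1 b1, uhg_rel r q x a1 b1 -> phi a1 = phi b1) ->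
  uhg_rel r q (fun g => phi (x g)) a b -> a = b.
Proof.
move=> phi_rel.
have G a1 b1 a' b' : uhg_rel r q x a1 b1 -> phi a1 = a' -> phi b1 = b' -> a' = b'.
  by move=> ab <- <-; exact: phi_rel.
case=> [|||||||s l|s l|s l s' l'||||s l|s l|s l||v v'|v|v|v|v|v s l].
- by apply: (G _ _ _ _ (rel_KX _ _ _)); push_morph.
- by apply: (G _ _ _ _ (rel_EX _ _ _)); push_morph.
- by apply: (G _ _ _ _ (rel_FX _ _ _)); push_morph.
- by apply: (G _ _ _ _ (rel_KE _ _ _)); push_morph.
- by apply: (G _ _ _ _ (rel_KF _ _ _)); push_morph.
- by apply: (G _ _ _ _ (rel_EF _ _ _)); push_morph.
- by apply: (G _ _ _ _ (rel_LX _ _ _)); push_morph.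
- by apply: (G _ _ _ _ (rel_LZ _ _ _ s l)); push_morph.
- by apply: (G _ _ _ _ (rel_ZX _ _ _ s l)); push_morph.
- by apply: (G _ _ _ _ (rel_ZZ _ _ _ s l s' l')); push_morph.
- by apply: (G _ _ _ _ (rel_LK _ _ _)); push_morph.
- by apply: (G _ _ _ _ (rel_LE _ _ _)); push_morph.
- by apply: (G _ _ _ _ (rel_LF _ _ _)); push_morph.
- by apply: (G _ _ _ _ (rel_KZ _ _ _ s l)); push_morph.
- by apply: (G _ _ _ _ (rel_EZ _ _ _ s l)); push_morph.
- by apply: (G _ _ _ _ (rel_FZ _ _ _ s l)); push_morph.
- by apply: (G _ _ _ _ (rel_S1 _ _ _)); push_morph.
- by apply: (G _ _ _ _ (rel_SS _ _ _ v v')); push_morph.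
- by apply: (G _ _ _ _ (rel_SE _ _ _ v)); push_morph.
- by apply: (G _ _ _ _ (rel_SF _ _ _ v)); push_morph.
- by apply: (G _ _ _ _ (rel_SK _ _ _ v)); push_morph.
- by apply: (G _ _ _ _ (rel_SL _ _ _ v)); push_morph.
- by apply: (G _ _ _ _ (rel_SZ _ _ _ v s l)); push_morph.
Qed.

Lemma uhg_gen_rel (K : fieldType) (p r : nat) (q : K) (r_dvd8 : (8 %| r)%N)
    (q_prim : r.-primitive_root q) (a b : uhg p r_dvd8 q_prim) :
  uhg_rel r q (@uhg_gen K p r q r_dvd8 q_prim) a b -> a = b.
Proof.
apply: (@uhg_rel_morph K p r q (free_alg K (gen p)) (uhg p r_dvd8 q_prim)
  (@free_gen K (gen p)) (qproj (uhg_rel_proper r_dvd8 q_prim))).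
by move=> a1 b1 ab; exact: uhg_genP.
Qed.

Theorem proposition7p20 (p : nat) (p_gt2 : (2 < p)%N) (p_prime : prime p)
    (K : closedFieldType) (charK : p \in [pchar K])
    (r : nat) (q : K) (r_dvd8 : (8 %| r)%N) (r_coprime_p : coprime r p)
    (q_prim : r.-primitive_root q)
    (alpha : 'I_p -> K) (alpha_neq0 : forall l, alpha l != 0)
    (H : hopf_structure p r_dvd8 q_prim)
    (lambda : {scalar uhg p r_dvd8 q_prim})
    (rt : K) (rtE : rt ^+ 2 = (r %/ 4)%:R)
    (lambda_int : left_integral H lambda)
    (lambda_val : integral_values rt lambda) :
  let M := monodromy (Rmatrix r_dvd8 q_prim alpha) in
  S2xS2_invariant H lambda M != 0 /\ susceptible_to_stabilisation H lambda M.
Proof.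
move=> M.
suff M0 : S2xS2_invariant H lambda M != 0 by rewrite /susceptible_to_stabilisation unitfE.
have n1 := half_gt1 r_dvd8 q_prim.
have t_lt : (r./2.-1 < r./2)%N by rewrite ltn_predL ltnW.
have b0 : qbrace q 1 != 0 by rewrite (qbrace_neq0 r_dvd8 q_prim).
have qf0 : qfact q r./2.-1 != 0 by rewrite (qfact_neq0 r_dvd8 q_prim).
have q0 : q != 0 by rewrite (prim_root_eq0 q_prim) -lt0n (prim_order_gt0 q_prim).
(* [r %/ 4] divides [r], hence is nonzero in [K]. *)
have rt0 : rt != 0.
  have : (r %/ 4)%:R != 0 :> K.
    by apply: (prim_root_dvd_eq0 q_prim); apply/dvdnP; exists 4;
      have [m _ ->] := r_quarter r_dvd8 q_prim; lia.
  by rewrite -rtE; apply: contra => /eqP->; rewrite expr0n.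
pose x := @uhg_gen K p r q r_dvd8 q_prim.
pose th a := qbrace q 1 ^+ a / qfact q a * q ^+ (a * a.-1)./2.
have Rmatrix_Rx : Rmatrix r_dvd8 q_prim alpha = Rx r q x alpha th.
  congr (_ * _); apply: eq_bigr => J _; apply: eq_bigr => -[l s] _.
  by [].
have lam_basis : forall a b c d, (a < r./2)%N -> (b < r./2)%N -> (c < r./2)%N -> (d < 2)%N ->
  forall g g' : 'I_p -> bool,
  lambda (x GenE ^+ a * x GenF ^+ b * x GenK ^+ c * x GenL ^+ d *
    \prod_(l < p) (x (GenZ true l) ^+ g l * x (GenZ false l) ^+ g' l)) =
  if [&& a == r./2.-1, b == r./2.-1, c == r./2.-1, d == 0%N & [forall l, g l && g' l]]
  then rt * qfact q (r./2).-1 / qbrace q 1 ^+ (r./2).-1 else 0.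
  move=> a b c d an bn cn dn g g'.
  (* Basis elements end with a permutation, here the identity, which has to be removed. *)
  have S_1 : aS r_dvd8 q_prim (1%g : 'S_p) = 1 by exact: uhg_gen_rel (rel_S1 r q x).
  transitivity (lambda (basis_elt r_dvd8 q_prim a b c d g g' 1%g)).
    exact: congr1 (esym (mul_eq1r _ S_1)).
  by rewrite lambda_val // [1%g == 1%g]eqxx andbT.
have [u u0 evM] := ev_monodromy r_dvd8 q_prim (@uhg_gen_rel _ _ _ _ r_dvd8 q_prim) alpha
  (antipode1 H) (antipodeM H) (antipodeK H) (antipodeE H) (antipodeF H) (antipodeZ H)
  lam_basis th.
rewrite /M Rmatrix_Rx -[S2xS2_invariant _ _ _]/(ev _ _ _) evM.
(* It remains that [th] at the top exponent, the top value of the integral and each doubled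
   [alpha l] are nonzero. *)
rewrite !mulf_neq0 // ?expf_neq0 // ?mulf_neq0 ?invr_neq0 ?expf_neq0 //.
apply/prodf_neq0 => l _; rewrite oppr_eq0 expf_neq0 // -mulr_natr mulf_neq0 //.
exact: two_neq0 r_dvd8 q_prim.
Qed.
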